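(* Let $\lambda>0$, $0<\nu\le 1$, and let $N^\nu(t)$, $t\ge 0$, be the fractional Poisson process of order $\nu$ with parameter $\lambda$. The bivariate distribution of the fractional Poisson process, for $t\ge s\ge 0$ and integers $r\ge k\ge 0$, reads $$\Pr\{N^\nu(s)=k,\ N^\nu(t)=r\}=\lambda^r\int_0^s w^{\nu k-1}E_{\nu,\nu k}^{k}(-\lambda w^\nu)\left[\int_{s-w}^{t-w} y^{\nu-1}E_{\nu,\nu}(-\lambda y^\nu)\,(t-w-y)^{\nu(r-k-1)}\,E_{\nu,\nu(r-k-1)+1}^{r-k}\bigl(-\lambda(t-w-y)^\nu\bigr)\,\mathrm dy\right]\mathrm dw ,$$ where $$E^\gamma_{\alpha,\eta}(z)=\sum_{j=0}^\infty \frac{\Gamma(\gamma+j)\,z^j}{j!\,\Gamma(\gamma)\,\Gamma(\alpha j+\eta)},\qquad \alpha,\eta,\gamma\in\mathbb C,\ \Re(\alpha),\Re(\eta),\Re(\gamma)>0,\ z\in\mathbb C,$$ is the generalised Mittag--Leffler function.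
   Context: Write $E_{\alpha,\eta}(z)=E^1_{\alpha,\eta}(z)$ for the generalised Mittag--Leffler function with upper parameter $1$. The fractional Poisson process $N^\nu(t)$, $t\ge0$, of order $\nu\in(0,1]$ and parameter $\lambda>0$ is the renewal counting process starting at $N^\nu(0)=0$ whose times between successive events (including the time to the first event) are i.i.d. with density $\lambda s^{\nu-1}E_{\nu,\nu}(-\lambda s^\nu)$, $s>0$. That is, $N^\nu(t)$ is the number of events occurring up to time $t$. For $\nu=1$ it is the homogeneous Poisson process of rate $\lambda$.
   Formalization: The formula is proved as printed for 1≤k<r; for k=0 or r=k it involves E^0 (undefined) and fails (k=0 at s=0, r=k at t=s>0): for k=0 the outer integral is replaced by evaluation at w=0, and for r=k the bracket is replaced by E_{ν,1}(-λ(t-w)^ν). *)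

(* Defs.v *)
From HB Require Import structures.
From mathcomp Require Import all_boot all_order all_algebra.
From mathcomp Require Import all_classical all_reals all_analysis.
Import Order.TTheory GRing.Theory Num.Theory.
Import numFieldNormedType.Exports.

Set Implicit Arguments.
Unset Strict Implicit.
Unset Printing Implicit Defensive.

Local Open Scope classical_set_scope.
Local Open Scope ring_scope.

(* Meaningful for 0 < x only: the integral diverges for x <= 0, and then the
   value is a junk 0. *)
Definition Gamma (R : realType) (x : R) : R :=
  \int[@lebesgue_measure R]_(y in `]0, +oo[) (y `^ (x - 1) * expR (- y)).

(* E^g_{a,b}(z), restricted to real arguments; meaningful for 0 < a, 0 < b and
   0 < g, where the series converges absolutely for every z. *)
Definition mittag_leffler (R : realType) (g a b z : R) : R :=
  limn (series (fun j : nat =>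
    Gamma (g + j%:R) * z ^+ j /
    (j`!%:R * Gamma g * Gamma (a * j%:R + b)))).

Definition mutually_independent (d : measure_display) (T : measurableType d)
    (R : realType) (P : probability T R) (X : nat -> {RV P >-> R}) : Prop :=
  forall (J : seq nat) (A : nat -> set R),
    uniq J -> (forall i, measurable (A i)) ->
    P (\bigcap_(i in [set` J]) (X i @^-1` A i)) =
      (\prod_(i <- J) P (X i @^-1` A i))%E.

(* The density f is only looked at on the positive half-line; X is then almost
   surely positive. *)
Definition has_positive_density (d : measure_display) (T : measurableType d)
    (R : realType) (P : probability T R) (X : {RV P >-> R}) (f : R -> R)
    : Prop :=
  forall A : set R, measurable A ->
    distribution P X A =
      (\int[@lebesgue_measure R]_(x in A `&` `]0%R, +oo[) (f x)%:E)%E.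

Definition fpp_density (R : realType) (lambda nu x : R) : R :=
  lambda * x `^ (nu - 1) * mittag_leffler 1 nu nu (- lambda * x `^ nu).

(* X n is the time between the n-th and the (n+1)-st event, so the sum below is
   the time of the (n+1)-st event. *)
Definition event_time (T : Type) (R : realType) (X : nat -> T -> R) (n : nat)
    (w : T) : R :=
  \sum_(i < n.+1) X i w.

(* N takes values in the extended reals because the number of events up to a
   given time may be infinite on a null set. *)
Definition fractional_poisson_process (d : measure_display)
    (T : measurableType d) (R : realType) (P : probability T R)
    (lambda nu : R) (N : R -> T -> \bar R) : Prop :=
  exists X : nat -> {RV P >-> R},
    [/\ mutually_independent X,
        forall n, has_positive_density (X n) (fpp_density lambda nu) &
        forall t w, 0 <= t ->
          N t w = counting [set n | event_time (fun i => X i : T -> R) n w <= t]].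

(* Main.v *)
Require Import Defs.
From HB Require Import structures.
From mathcomp Require Import all_boot all_order all_algebra.
From mathcomp Require Import all_classical all_reals all_analysis.
From mathcomp Require Import measurable_realfun ring lra.
Import Order.TTheory GRing.Theory Num.Theory.
Import numFieldNormedType.Exports.

(** Let X_0, X_1, ... be the interarrival times, f their density, and
    T_k = X_0 + ... + X_(k-1) the time of the k-th event.  The X_i are almost
    surely positive, so that N(s) = k means T_k <= s < T_(k+1), and the theorem is
    about two such events ([prob_counting]).

    For k < r, condition on w = T_k and on y = X_k: the event says that w <= s,
    that y > s - w, and that exactly m = r - k - 1 further events follow the
    (k+1)-st one in the remaining time t - w - y.  After an event the process
    starts afresh; hence, if p_m(u) is the probability of m events up to time u,
    the probability is the integral over w in [0, s], under the law of T_k, of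
    the integral over y > s - w of f(y) p_m(t - w - y) ([prob_counts_lt]).  For
    r = k one has instead w <= s and y > t - w ([prob_counts_eq]); for k = 0 the
    law of T_k is the Dirac mass at 0.  The conditioning rests on the uniqueness
    of product measures: an event that concerns X_0, ..., X_(n-1) only is
    independent of X_n, even jointly with T_n, so that T_n may be held fixed when
    integrating over X_n ([freezing], [prob_renewals]).

    It remains to find the law of T_k and p_m.  With z = - lambda, put
    q_{k,b}(x) = x^(b-1) E^k_{nu,b}(z x^nu) for x > 0 and 1 <= k, and
    q_{0,b}(x) = x^(b-1) / Gamma(b).  By definition f = lambda q_{1,nu}.  All
    follows from the convolution identity
      q_{k,b} * q_{1,c} = q_{k+1,b+c}   ([ml_kernel_convolves]):
    T_k has density lambda^k q_{k,nu k} ([integral_arrival]), and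
    p_m = lambda^m q_{m+1,nu m+1} ([renewal_prob_kernel]).  These are the two
    factors of the formula besides f.

    For the identity, the Beta integral is the convolution of two powers
    ([power_kernel_convolution]), and integrating the series of q_{k,b} term by
    term gives q_{k,b} * q_{0,c} = q_{k,b+c}.  The series of q_{1,c} is the sum of
    the z^j q_{0,c+nu j}, whence q_{k,b} * q_{1,c} is the sum of the
    z^j q_{k,b+c+nu j}.  This sum is q_{k+1,b+c}: Pascal's rule for the
    coefficients reads q_{k+1,b} = q_{k,b} + z q_{k+1,b+nu}, and iterating it
    leaves a remainder that tends to 0 ([cvg_ml_kernel_series]).  Both exchanges
    of sum and integral are dominated by the same series at |z|, whose terms are
    nonnegative and whose sum is finite because Gamma grows faster than every
    geometric sequence ([Gamma_ge]).

    For z < 0 the sign of q_{k,b} is not visible on its series.  But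
    lambda q_{1,nu} is the density of a probability law, hence nonnegative almost
    everywhere ([ae_kernel1_ge0]); convolutions inherit this ([ae_kernel_ge0]),
    and Tonelli's theorem can be used throughout. *)

Set Implicit Arguments.
Unset Strict Implicit.
Unset Printing Implicit Defensive.

Local Open Scope classical_set_scope.
Local Open Scope ring_scope.

(** * Changes of variables and of measure *)

Definition mfun_of d1 d2 (T1 : measurableType d1) (T2 : measurableType d2)
    (f : T1 -> T2) (mf : measurable_fun setT f) : {mfun T1 >-> T2} :=
  HB.pack f (isMeasurableFun.Build _ _ _ _ _ mf).

Section lebesgue_affine.
Context {R : realType}.
Local Notation mu := (@lebesgue_measure R).
Implicit Types f : R -> \bar R.

(** Lebesgue measure is determined by the lengths of half-open intervals, and
    the right-hand side gives them the right length. *)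
Lemma lebesgue_measure_affine (c : {posnum R}) (a : R) (A : set R) :
  measurable A ->
  mu A = (c%:num%:E * mu ((fun x => c%:num * x + a)%R @^-1` A))%E.
Proof.
move=> mA.
have mS : measurable_fun [set: measurableTypeR R]
    ((fun x => c%:num * x + a) : measurableTypeR R -> measurableTypeR R).
  by apply: measurable_funD => //; exact: measurable_funM.
rewrite (@lebesgue_measure_unique _
  (mscale (NngNum (ltW [gt0 of c%:num])) (pushforward mu (mfun_of mS))))//.
move=> _ [[u v]] _ <- /=.
rewrite /mscale/= /pushforward/=.
rewrite (_ : _ @^-1` _ = `](u - a) / c%:num, (v - a) / c%:num]%classic).
  rewrite !lebesgue_measure_itv/= !lte_fin ltr_pM2r ?invr_gt0// ltrD2r.
  case: ifP => // _; rewrite ?mule0// -!EFinB -EFinM -mulrBl mulrC divfK//.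
  by congr EFin; ring.
apply/seteqP; split => x /=; rewrite !in_itv/=;
  by rewrite ltr_pdivrMr// ler_pdivlMr// ltrBlDr lerBrDr mulrC.
Qed.

Lemma ge0_integral_affine (c a : R) f : 0 < c -> measurable_fun setT f ->
  (forall x, (0 <= f x)%E) ->
  (c%:E * \int[mu]_x f (c * x + a)%R = \int[mu]_x f x)%E.
Proof.
move=> c0 mf f0; pose C := PosNum c0.
have mS : measurable_fun [set: measurableTypeR R]
    ((fun x => c * x + a) : measurableTypeR R -> measurableTypeR R).
  by apply: measurable_funD => //; exact: measurable_funM.
rewrite [RHS](eq_measure_integral
    (mscale (NngNum (ltW c0)) (pushforward mu (mfun_of mS)))); last first.
  by move=> A mA _; exact: (lebesgue_measure_affine C).
by rewrite ge0_integral_mscale//= ge0_integral_pushforward.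
Qed.

Lemma ge0_integral_shift (a : R) f : measurable_fun setT f ->
  (forall x, (0 <= f x)%E) ->
  (\int[mu]_x f (x + a)%R = \int[mu]_x f x)%E.
Proof.
move=> mf f0; rewrite -(ge0_integral_affine a ltr01 mf f0) mul1e.
by under [in RHS]eq_integral do rewrite mul1r.
Qed.

Lemma ge0_integral_scale (c : R) f : 0 < c -> measurable_fun setT f ->
  (forall x, (0 <= f x)%E) ->
  (c%:E * \int[mu]_x f (c * x)%R = \int[mu]_x f x)%E.
Proof.
move=> c0 mf f0; rewrite -(ge0_integral_affine 0 c0 mf f0).
by under [in RHS]eq_integral do rewrite addr0.
Qed.

End lebesgue_affine.

(** The hypothesis makes F a Radon-Nikodym derivative of nu, and such a
    derivative is unique up to a null set. *)
Lemma ge0_integral_density d (T : measurableType d) (R : realType)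
    (mu : {sigma_finite_measure set T -> \bar R})
    (nu : {finite_measure set T -> \bar R}) (F : T -> R) (f : T -> \bar R) :
  measurable_fun setT F ->
  (forall A, measurable A -> nu A = (\int[mu]_(x in A) (F x)%:E)%E) ->
  measurable_fun setT f -> (forall x, (0 <= f x)%E) ->
  (\int[nu]_x f x = \int[mu]_x ((F x)%:E * f x))%E.
Proof.
move=> mF nuF mf f0.
have numu : nu `<< mu.
  apply/null_content_dominatesP => A mA A0; rewrite nuF//.
  by apply: null_set_integral => //; exact/measurable_funTS/measurable_EFinP.
rewrite -(Radon_Nikodym_SigmaFinite.change_of_variables numu f0 measurableT mf).
have mRN := measurable_int _ (Radon_Nikodym_SigmaFinite.f_integrable numu).
apply: ae_eq_integral => //.
- exact: emeasurable_funM.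
- by apply: emeasurable_funM => //; exact/measurable_EFinP.
have FF : ae_eq mu setT (Radon_Nikodym_SigmaFinite.f nu mu) (EFin \o F).
  apply: integral_ae_eq => //.
  - exact: Radon_Nikodym_SigmaFinite.f_integrable.
  - exact/measurable_EFinP.
  - by move=> A _ mA; rewrite -nuF// -Radon_Nikodym_SigmaFinite.f_integral.
by apply: filterS FF => x /= /(_ I) ->; rewrite muleC.
Qed.

(** * The Gamma function *)

Section gamma.
Context {R : realType}.
Local Notation mu := (@lebesgue_measure R).

(** The bound does not depend on e: letting e tend to 0 gives the integrability
    of y^(b - 1) at 0, where b - 1 may be negative. *)
Lemma integral_powR_ball1 (b e : R) : 0 < b -> 0 < e < 1 ->
  (\int[mu]_(y in `[e, 1%R]) (y `^ (b - 1))%:E <= (b^-1)%:E)%E.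
Proof.
move=> b0 /andP[e0 e1].
have ypos y : e <= y -> 0 < y by apply: lt_le_trans.
have cpow c (y : R) : 0 < y -> {for y, continuous (fun x : R => x `^ c)}.
  move=> y0; apply/differentiable_continuous/derivable1_diffP/derivable_powR.
  by rewrite in_itv/= y0.
have cF (y : R) : 0 < y -> {for y, continuous (fun x : R => x `^ b / b)}.
  by move=> y0; apply: cvgMl; exact: cpow.
rewrite (@continuous_FTC2 _ _ (fun y => y `^ b / b)) //.
- by rewrite powR1 -EFinB lee_fin mul1r gerBl divr_ge0 ?powR_ge0// ltW.
- apply: continuous_in_subspaceT => y /set_mem/=; rewrite in_itv/= => /andP[ey _].
  exact/cpow/ypos.
- split.
  + move=> y; rewrite in_itv/= => /andP[/ltW/ypos y0 _].
    by apply: derivableM => //; apply: derivable_powR; rewrite in_itv/= y0.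
  + exact/cvg_at_right_filter/cF.
  + exact/cvg_at_left_filter/cF.
- move=> y; rewrite in_itv/= => /andP[/ltW/ypos y0 _].
  rewrite derive1Mr ?powR_derive1 ?in_itv/= ?y0//.
    by rewrite mulrAC divff ?mul1r// gt_eqF.
  by apply: derivable_powR; rewrite in_itv/= y0.
Qed.

Lemma integral_powR_unit (b : R) : 0 < b ->
  (\int[mu]_(y in `]0%R, 1%R]) (y `^ (b - 1))%:E <= (b^-1)%:E)%E.
Proof.
move=> b0.
have -> : `]0%R, 1%R]%classic = \bigcup_n `[(n.+2%:R^-1 : R), 1%R]%classic.
  apply/seteqP; split => x /=; rewrite in_itv/=.
    move=> /andP[x0 x1]; have [n _ nx] : \forall n \near \oo, n.+1%:R^-1 < x.
      exact: near_infty_natSinv_lt (PosNum x0).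
    exists n => //=; rewrite in_itv/= x1 andbT; apply: ltW.
    exact: (nx n.+1) (leqnSn n).
  move=> [n _]/=; rewrite in_itv/= => /andP[nx ->]; rewrite andbT.
  by apply: lt_le_trans nx; rewrite invr_gt0.
have cvgI : (\int[mu]_(y in `[n.+2%:R^-1%R, 1%R]) (y `^ (b - 1))%:E)%E
    @[n --> \oo] -->
    (\int[mu]_(y in \bigcup_n `[n.+2%:R^-1%R, 1%R]%classic) (y `^ (b - 1))%:E)%E.
  apply: ge0_nondecreasing_set_cvg_integral.
  - apply/nondecreasing_seqP => n; rewrite subsetEset => y /=.
    rewrite !in_itv/= => /andP[ny ->]; rewrite andbT.
    by apply: le_trans ny; rewrite lef_pV2 ?posrE// ler_nat.
  - by move=> n; exact: measurable_itv.
  - move=> n; apply/measurable_EFinP; apply: measurable_funTS.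
    exact: measurable_powR.
  - by move=> n y _; rewrite lee_fin powR_ge0.
move/cvg_lim : (cvgI) => <- //.
apply: lime_le; first by apply/cvg_ex; eexists; exact: cvgI.
apply: nearW => n; apply: integral_powR_ball1 => //.
by rewrite invr_gt0 ltr0n/= invf_lt1// ltr1n.
Qed.

(** Half of the exponential beats the power, which leaves the other half, a
    multiple of the density of an exponential law. *)
Lemma powR_expR_bound (b : R) : exists2 C : R, 0 <= C &
  forall y, 1 <= y -> y `^ (b - 1) * expR (- y) <= C * expR (- (2^-1 * y)).
Proof.
pose n := Num.bound `|b|.
have bn : b <= n%:R.
  by rewrite (le_trans (ler_norm b))// ltW// archi_boundP.
exists (2 ^+ n.+1 * n.+1`!%:R); first by rewrite mulr_ge0.
move=> y y1; have y0 : 0 <= y by apply: le_trans y1.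
have h2 : 2 != 0 :> R by [].
have -> : expR (- y) = expR (- (2^-1 * y)) * expR (- (2^-1 * y)).
  by rewrite -expRD; congr expR; field.
rewrite mulrA ler_wpM2r ?expR_ge0// expRN ler_pdivrMr ?expR_gt0//.
apply: (@le_trans _ _ (y ^+ n.+1)).
  rewrite -powR_mulrn//; apply: ler_powR => //.
  by rewrite lerBlDr (le_trans bn)// -natr1 -addrA lerDl.
have := @expR_ge1Dxn R (2^-1 * y) n; rewrite mulr_ge0// => /(_ isT) h.
have {}h : (2^-1 * y) ^+ n.+1 / n.+1`!%:R <= expR (2^-1 * y).
  by apply: le_trans h; rewrite lerDr.
rewrite ler_pdivrMr in h; last by rewrite ltr0n fact_gt0.
rewrite exprMn exprVn mulrC ler_pdivrMr ?exprn_gt0// in h.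
by apply: le_trans h _; rewrite -mulrA mulrC (mulrC _`!%:R).
Qed.

Lemma measurable_gamma_integrand (D : set R) (b : R) :
  measurable_fun D (fun y : R => (y `^ (b - 1) * expR (- y))%:E).
Proof.
apply/measurable_EFinP; apply: measurable_funTS; apply: measurable_funM.
  exact: measurable_powR.
by apply: measurableT_comp => //; exact: measurable_expR.
Qed.

Lemma integral_gamma_lty (b : R) : 0 < b ->
  (\int[mu]_(y in `]0%R, +oo[) (y `^ (b - 1) * expR (- y))%:E < +oo)%E.
Proof.
move=> b0.
have nn y : (0 <= (y `^ (b - 1) * expR (- y))%:E)%E.
  by rewrite lee_fin mulr_ge0 ?powR_ge0 ?expR_ge0.
have -> : `]0%R, +oo[%classic = `]0%R, 1%R] `|` `]1%R, +oo[ :> set R.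
  apply/seteqP; split => y /=; rewrite !in_itv/= ?andbT.
    by move=> y0; case: (leP y 1) => y1; [left|right]; rewrite ?y0.
  by case=> [/andP[]//|]; apply: lt_trans.
rewrite ge0_integral_setU//=; last 2 first.
- exact: measurable_gamma_integrand.
- by apply/disj_setPS => y []/=; rewrite !in_itv/= => /andP[_ /le_lt_trans h] /andP[/h]; rewrite ltxx.
apply: lte_add_pinfty.
  apply: (@le_lt_trans _ _ (b^-1)%:E); last exact: ltry.
  apply: le_trans (integral_powR_unit b0).
  apply: ge0_le_integral => //.
  - exact: measurable_gamma_integrand.
  - by apply/measurable_EFinP; apply: measurable_funTS; exact: measurable_powR.
  - move=> y /=; rewrite in_itv/= => /andP[y0 _].
    by rewrite lee_fin ler_piMr ?powR_ge0// expR_le1 oppr_le0 ltW.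
have [C C0 hC] := powR_expR_bound b.
apply: (@le_lt_trans _ _
    (\int[mu]_y ((C * 2)%:E * (exponential_pdf 2^-1 y)%:E))%E); last first.
  rewrite ge0_integralZl_EFin//.
  - by rewrite integral_exponential_pdf ?mule1 ?ltry.
  - by move=> y _; rewrite lee_fin exponential_pdf_ge0.
  - by apply/measurable_EFinP; exact: measurable_exponential_pdf.
  - by rewrite mulr_ge0.
rewrite integral_mkcond.
apply: ge0_le_integral => //.
- by move=> y _; rewrite erestrict_ge0.
- apply/(measurable_restrictT (fun y : R => (y `^ (b - 1) * expR (- y))%:E)) => //.
  exact: measurable_gamma_integrand.
- apply: emeasurable_funM => //.
  by apply/measurable_EFinP; exact: measurable_exponential_pdf.
move=> y _; rewrite /patch; case: ifPn.
  rewrite inE/= in_itv/= andbT => y1.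
  rewrite -EFinM lee_fin exponential_pdfE ?(le_trans _ (ltW y1))//.
  by rewrite mulrA mulfK// mulNr hC// ltW.
by move=> _; rewrite -EFinM lee_fin !mulr_ge0// exponential_pdf_ge0.
Qed.

Lemma GammaE (b : R) : 0 < b ->
  (\int[mu]_(y in `]0%R, +oo[) (y `^ (b - 1) * expR (- y))%:E = (Gamma b)%:E)%E.
Proof.
move=> b0; rewrite /Gamma /Rintegral fineK// ge0_fin_numE ?integral_gamma_lty//.
by apply: integral_ge0 => y _; rewrite lee_fin mulr_ge0 ?powR_ge0 ?expR_ge0.
Qed.

Lemma Gamma1 : Gamma (1 : R) = 1.
Proof.
apply/EFin_inj; rewrite -GammaE// -(@integral_exponential_pdf R 1)//.
rewrite [RHS](_ : _ = \int[mu]_(x in `[0%R, +oo[) (exponential_pdf 1 x)%:E)%E; last first.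
  rewrite [RHS]integral_mkcond; apply: eq_integral => x _.
  rewrite /patch; case: ifPn => //.
  rewrite notin_setE/= in_itv/= andbT => /negP; rewrite -ltNge => x0.
  by rewrite lt0_exponential_pdf.
rewrite -integral_itv_obnd_cbnd; last first.
  by apply/measurable_EFinP; apply: measurable_funTS; exact: measurable_exponential_pdf.
apply: eq_integral => x; rewrite inE/= in_itv/= andbT => x0.
by rewrite exponential_pdfE ?ltW// subrr powRr0 mul1r mulN1r mul1r.
Qed.

(** Keeping only the interval [A, A + 1] of Euler's integral bounds Gamma from
    below by a multiple of A^b, with a factor that does not depend on b.  As A
    is arbitrary, Gamma grows faster than every geometric sequence: this is all
    that the convergence of Mittag-Leffler series asks for, and it replaces
    Stirling's formula. *)
Lemma Gamma_ge (b A : R) : 0 < b -> 0 < A ->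
  A `^ b * (expR (- (A + 1)) / (A + 1)) <= Gamma b.
Proof.
move=> b0 A0; rewrite -lee_fin -GammaE//.
have A1 : 0 < A + 1 by rewrite addr_gt0.
apply: (@le_trans _ _ (\int[mu]_(y in `[A, (A + 1)%R])
   (A `^ b * (expR (- (A + 1)) / (A + 1)))%:E)%E).
  rewrite integral_cst//= lebesgue_measure_itv/= lte_fin ltrDl ltr01.
  by rewrite -EFinB [(A + 1)%R]addrC addrK mule1.
apply: (@le_trans _ _ (\int[mu]_(y in `[A, (A + 1)%R])
   (y `^ (b - 1) * expR (- y))%:E)%E); last first.
  apply: ge0_subset_integral => //.
  - exact: measurable_gamma_integrand.
  - by move=> y _; rewrite lee_fin mulr_ge0 ?powR_ge0 ?expR_ge0.
  - move=> y /=; rewrite !in_itv/= andbT => /andP[Ay _].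
    exact: lt_le_trans Ay.
apply: ge0_le_integral => //.
- by move=> y _; rewrite lee_fin mulr_ge0 ?powR_ge0// divr_ge0 ?expR_ge0// ltW.
- exact: measurable_gamma_integrand.
move=> y /=; rewrite in_itv/= => /andP[Ay yA]; rewrite lee_fin.
have y0 : 0 < y by apply: lt_le_trans Ay.
(* Written as y^b times exp(-y)/y, the integrand is a product of an increasing
   and a decreasing function of y. *)
rewrite (_ : y `^ (b - 1) = y `^ b / y); last first.
  by rewrite powRB ?powRr1 ?(ltW y0)//; apply/implyP => _; rewrite gt_eqF.
have -> : y `^ b / y * expR (- y) = y `^ b * (expR (- y) / y) by ring.
have h1 : A `^ b <= y `^ b by apply: ge0_ler_powR; rewrite ?nnegrE ?(ltW b0) ?(ltW A0) ?(ltW y0).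
have h2 : expR (- (A + 1)) <= expR (- y) by rewrite ler_expR lerN2.
have h3 : (A + 1)^-1 <= y^-1 by rewrite lef_pV2.
by apply: ler_pM; rewrite ?powR_ge0 ?mulr_ge0 ?invr_ge0 ?expR_ge0 ?(ltW A1)//;
  apply: ler_pM; rewrite ?invr_ge0 ?expR_ge0 ?(ltW A1).
Qed.

Lemma Gamma_gt0 (b : R) : 0 < b -> 0 < Gamma b.
Proof.
move=> b0; apply: lt_le_trans (Gamma_ge b0 ltr01).
by rewrite mulr_gt0 ?powR_gt0// divr_gt0 ?expR_gt0.
Qed.

End gamma.

(** * Power kernels and the Beta integral *)

Section tonelli_convolution.
Context {R : realType}.
Local Notation mu := (@lebesgue_measure R).
Implicit Types f g phi : R -> \bar R.

(** Two applications of Tonelli's theorem, around the translation v = w + x.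
    Read for densities f and g, it says that the sum of independent variables
    has density f * g. *)
Lemma ge0_integral_convolution f g phi :
  measurable_fun setT f -> measurable_fun setT g -> measurable_fun setT phi ->
  (forall x, (0 <= f x)%E) -> (forall x, (0 <= g x)%E) ->
  (forall x, (0 <= phi x)%E) ->
  (\int[mu]_w (f w * \int[mu]_x (g x * phi (w + x)%R)) =
   \int[mu]_v (phi v * \int[mu]_x (f (v - x)%R * g x)))%E.
Proof.
move=> mf mg mphi f0 g0 phi0.
have m1 : measurable_fun setT (fun z : R * R => f z.1 * (g z.2 * phi (z.1 + z.2)%R))%E.
  apply: emeasurable_funM; first exact: measurableT_comp.
  apply: emeasurable_funM; first exact: measurableT_comp.
  by apply: measurableT_comp => //; exact: measurable_funD.
have m2 : measurable_fun setT (fun z : R * R => phi z.2 * (f (z.2 - z.1)%R * g z.1))%E.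
  apply: emeasurable_funM; first exact: measurableT_comp.
  apply: emeasurable_funM; last exact: measurableT_comp.
  by apply: measurableT_comp => //; exact: measurable_funB.
transitivity (\int[mu]_w \int[mu]_x (f w * (g x * phi (w + x)%R)))%E.
  apply: eq_integral => w _; rewrite ge0_integralZl//.
  - apply: emeasurable_funM => //.
    by apply: measurableT_comp => //; exact: measurable_funD.
  - by move=> x _; rewrite mule_ge0.
etransitivity.
  apply: (@fubini_tonelli _ _ _ _ _ mu mu (fun z : R * R => f z.1 * (g z.2 * phi (z.1 + z.2)%R))%E) => //.
  by move=> z; rewrite !mule_ge0.
transitivity (\int[mu]_x \int[mu]_v (phi v * (f (v - x)%R * g x)))%E.
  apply: eq_integral => x _.
  rewrite -[RHS](ge0_integral_shift x)//.
  - by apply: eq_integral => w _; rewrite addrK muleA muleC.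
  - apply: emeasurable_funM => //; apply: emeasurable_funM => //.
    by apply: measurableT_comp => //; exact: measurable_funB.
  - by move=> v; rewrite !mule_ge0.
etransitivity.
  apply: (@fubini_tonelli _ _ _ _ _ mu mu (fun z : R * R => phi z.2 * (f (z.2 - z.1)%R * g z.1))%E) => //.
  by move=> z; rewrite !mule_ge0.
apply: eq_integral => v _ /=; rewrite ge0_integralZl//.
- apply: emeasurable_funM => //.
  by apply: measurableT_comp => //; exact: measurable_funB.
- by move=> x _; rewrite mule_ge0.
Qed.

End tonelli_convolution.

Section power_kernel.
Context {R : realType}.
Local Notation mu := (@lebesgue_measure R).

(** The kernel of the Riemann-Liouville fractional integral of order b.  It is
    extended by 0, so that convolutions on the half-line become integrals over
    the whole line without bounds to keep track of. *)
Definition power_kernel (b x : R) : R :=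
  if 0 < x then x `^ (b - 1) / Gamma b else 0.

Lemma power_kernel_ge0 (b x : R) : 0 < b -> 0 <= power_kernel b x.
Proof.
move=> b0; rewrite /power_kernel; case: ifP => // _.
by rewrite divr_ge0 ?powR_ge0// ltW// Gamma_gt0.
Qed.

Lemma power_kernel_le0 (b x : R) : x <= 0 -> power_kernel b x = 0.
Proof. by rewrite /power_kernel leNgt => /negbTE ->. Qed.

Lemma power_kernel_scale (b x y : R) : 0 < x ->
  power_kernel b (x * y) = x `^ (b - 1) * power_kernel b y.
Proof.
move=> x0; rewrite /power_kernel pmulr_rgt0//; case: ifP => y0; last by rewrite mulr0.
by rewrite powRM ?ltW// mulrA.
Qed.

Lemma measurable_power_kernel (b : R) : measurable_fun setT (power_kernel b).
Proof.
apply: measurable_fun_ifT => //.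
- exact: measurable_fun_ltr.
- by apply: measurable_funM => //; exact: measurable_powR.
Qed.

Lemma integral_power_kernel_exp (b : R) : 0 < b ->
  (\int[mu]_x ((power_kernel b x)%:E * (expR (- x))%:E) = 1)%E.
Proof.
move=> b0; have Gb := Gamma_gt0 b0.
transitivity ((Gamma b)^-1%:E *
    \int[mu]_(y in `]0%R, +oo[) (y `^ (b - 1) * expR (- y))%:E)%E; last first.
  by rewrite GammaE// -EFinM mulVf// gt_eqF.
rewrite -ge0_integralZl//.
- rewrite [RHS]integral_mkcond; apply: eq_integral => x _.
  rewrite /patch /power_kernel mem_setE in_itv/= andbT.
  by case: ifPn => _; rewrite ?mul0e// -!EFinM; congr EFin; ring.
- exact: measurable_gamma_integrand.
- by move=> y _; rewrite lee_fin mulr_ge0 ?powR_ge0 ?expR_ge0.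
- by rewrite lee_fin invr_ge0 ltW.
Qed.

Lemma power_kernel_convolution_scale (a b x : R) : 0 < a -> 0 < b -> 0 < x ->
  (\int[mu]_y ((power_kernel a (x - y))%:E * (power_kernel b y)%:E) =
   (x `^ (a + b - 1))%:E *
   \int[mu]_y ((power_kernel a (1 - y))%:E * (power_kernel b y)%:E))%E.
Proof.
move=> a0 b0 x0.
have mk c (z : R) : measurable_fun setT (fun y : R => (power_kernel c (z - y))%:E).
  apply/measurable_EFinP; apply: measurableT_comp; first exact: measurable_power_kernel.
  exact: measurable_funB.
have mb : measurable_fun setT (EFin \o power_kernel b).
  by apply/measurable_EFinP; exact: measurable_power_kernel.
rewrite -(ge0_integral_scale x0)/=; last 2 first.
- by apply: emeasurable_funM; [exact: mk|exact: mb].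
- by move=> y; rewrite mule_ge0// lee_fin power_kernel_ge0.
have -> : a + b - 1 = (a - 1) + (b - 1) + 1 by ring.
rewrite powRD; last by rewrite (gt_eqF x0) implybT.
rewrite (powRr1 (ltW x0)) EFinM [RHS]muleAC [RHS]muleC.
apply: (congr1 (mule x%:E)).
rewrite powRD; last by rewrite (gt_eqF x0) implybT.
rewrite -ge0_integralZl//.
- apply: eq_integral => y _.
  have -> : x - x * y = x * (1 - y) by ring.
  by rewrite !power_kernel_scale// -!EFinM mulrACA.
- by apply: emeasurable_funM; [exact: mk|exact: mb].
- by move=> y _; rewrite mule_ge0// lee_fin power_kernel_ge0.
- by rewrite lee_fin mulr_ge0 ?powR_ge0.
Qed.

(** This is Euler's Beta integral.  By homogeneity the convolution is a multiple
    of the kernel of order a + b; integrated against exp(- x), each kernel has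
    mass 1 and convolutions have the product of the masses, so that the factor
    is 1. *)
Lemma power_kernel_convolution (a b x : R) : 0 < a -> 0 < b ->
  (\int[mu]_y ((power_kernel a (x - y))%:E * (power_kernel b y)%:E) =
   (power_kernel (a + b) x)%:E)%E.
Proof.
move=> a0 b0; have ab0 := addr_gt0 a0 b0.
have Gab := Gamma_gt0 ab0.
pose B := (\int[mu]_y ((power_kernel a (1 - y))%:E * (power_kernel b y)%:E))%E.
have B0 : (0 <= B)%E.
  by apply: integral_ge0 => y _; rewrite mule_ge0// lee_fin power_kernel_ge0.
have mk c : measurable_fun setT (fun y : R => (power_kernel c y)%:E).
  by apply/measurable_EFinP; exact: measurable_power_kernel.
have me : measurable_fun setT (fun y : R => (expR (- y))%:E).
  by apply/measurable_EFinP; apply: measurableT_comp => //; exact: measurable_expR.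
have convE z : (\int[mu]_y ((power_kernel a (z - y))%:E * (power_kernel b y)%:E) =
   (Gamma (a + b))%:E * B * (power_kernel (a + b) z)%:E)%E.
  have [z0|z0] := ltP 0 z.
    rewrite power_kernel_convolution_scale// -/B muleAC -EFinM; congr (_%:E * _)%E.
    by rewrite /power_kernel z0 mulrC divfK// gt_eqF.
  rewrite [in RHS]power_kernel_le0// mule0 integral0_eq// => y _.
  have [y0|y0] := ltP 0 y; last by rewrite [X in (_ * X%:E)%E]power_kernel_le0// mule0.
  by rewrite power_kernel_le0 ?mul0e// subr_le0 (le_trans z0)// ltW.
have : (\int[mu]_w ((power_kernel a w)%:E *
      \int[mu]_y ((power_kernel b y)%:E * (expR (- (w + y)))%:E)) = 1)%E.
  rewrite -[RHS](integral_power_kernel_exp a0); apply: eq_integral => w _.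
  congr (_ * _)%E; rewrite -[RHS]mule1 -[in RHS](integral_power_kernel_exp b0).
  rewrite -ge0_integralZl//.
  - by apply: eq_integral => y _; rewrite opprD expRD EFinM muleCA.
  - by apply: emeasurable_funM; [exact: mk|exact: me].
  - by move=> y _; rewrite mule_ge0// lee_fin ?power_kernel_ge0 ?expR_ge0.
rewrite (ge0_integral_convolution (mk a) (mk b) me); last 3 first.
- by move=> y; rewrite lee_fin power_kernel_ge0.
- by move=> y; rewrite lee_fin power_kernel_ge0.
- by move=> y; rewrite lee_fin expR_ge0.
rewrite (_ : integral _ _ _ = (Gamma (a + b))%:E * B)%E; last first.
  transitivity (\int[mu]_v (((Gamma (a + b))%:E * B) *
       ((power_kernel (a + b) v)%:E * (expR (- v))%:E)))%E.
    by apply: eq_integral => v _; rewrite convE muleCA [(_ * (expR _)%:E)%E]muleC.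
  rewrite ge0_integralZl//.
  - by rewrite integral_power_kernel_exp ?mule1.
  - by apply: emeasurable_funM; [exact: mk|exact: me].
  - by move=> y _; rewrite mule_ge0// lee_fin ?power_kernel_ge0 ?expR_ge0.
  - by rewrite mule_ge0// lee_fin ltW.
by move=> GB; rewrite convE GB mul1e.
Qed.

Lemma power_kernel1 (x : R) : 0 < x -> power_kernel 1 x = 1.
Proof. by move=> x0; rewrite /power_kernel x0 subrr powRr0 Gamma1 divr1. Qed.

(** The case b = 1 of the Beta integral, evaluated at x = 1, compares Gamma(n + 1)
    and Gamma(n + 2) through the integral of (1 - x)^n over the unit interval. *)
Lemma Gamma_nat (n : nat) : Gamma (n.+1%:R : R) = n`!%:R.
Proof.
elim: n => [|n IHn]; first by rewrite Gamma1.
have G0 : 0 < Gamma (n.+1%:R : R) by apply: Gamma_gt0.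
have mE (D : set R) : measurable_fun D (fun x : R => ((1 - x) ^+ n)%:E).
  apply/measurable_EFinP; apply: measurable_funTS.
  by apply: measurable_funX; exact: measurable_funB.
have : ((Gamma n.+1%:R : R)%:E * \int[mu]_y
    ((power_kernel n.+1%:R (1 - y))%:E * (power_kernel 1 y)%:E) =
    \int[mu]_(x in `[0%R, 1%R]) ((1 - x) ^+ n)%:E)%E.
  rewrite (@integral_itv_bndoo R 0 1 _ true false)// -ge0_integralZl//.
  - rewrite [RHS]integral_mkcond; apply: eq_integral => x _.
    rewrite /patch mem_setE in_itv/= /power_kernel subr_gt0.
    case: (ltP 0 x) => x0; last by rewrite !mule0.
    case: (ltP x 1) => x1; last by rewrite mul0e mule0.
    rewrite subrr powRr0 Gamma1 invr1 -!EFinM !mulr1 mulrC divfK ?gt_eqF//.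
    by rewrite -natr1 addrK powR_mulrn// subr_ge0 ltW.
  - apply: emeasurable_funM; apply/measurable_EFinP.
      apply: measurableT_comp; first exact: measurable_power_kernel.
      exact: measurable_funB.
    exact: measurable_power_kernel.
  - by move=> y _; rewrite mule_ge0// lee_fin power_kernel_ge0.
  - by rewrite lee_fin ltW.
rewrite power_kernel_convolution// natr1 /power_kernel ltr01 powR1 mul1r.
move/(congr1 fine); rewrite -[RHS]/(Rintegral _ _ _) Rintegral_onemXn /= => GG.
have G1 : 0 < Gamma (n.+2%:R : R) by apply: Gamma_gt0.
rewrite -[LHS]invrK -[X in X^-1](mulKf (lt0r_neq0 G0)) GG IHn.
by rewrite invfM !invrK factS natrM mulrC.
Qed.

End power_kernel.

(** * Mittag-Leffler kernels *)

(** Partial sums, rather than sums, are compared here because the recurrence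
    shifts the index: the sum of v is cut one term later than that of w. *)
Lemma series_pascal (R : realType) (z : R) (u v w : R^nat) :
  u 0%N = v 0%N -> (forall j, u j.+1 = v j.+1 + z * w j) ->
  forall n, series u n.+1 = series v n.+1 + z * series w n.
Proof.
move=> uv0 uvw; elim=> [|n IHn].
  by rewrite /series/= !big_nat1 big_geq// mulr0 addr0.
by rewrite seriesSr IHn uvw [in RHS]seriesSr [series w n.+1]seriesSr mulrDr addrACA.
Qed.

Lemma series_shift_le (R : realType) (c : R) (u w : R^nat) (J : nat) :
  (forall j, c * w j <= u (J + j)%N) ->
  forall n, series u J + c * series w n <= series u (J + n)%N.
Proof.
move=> wu; elim=> [|n IHn].
  by rewrite addn0 /series/= [X in c * X]big_geq// mulr0 addr0.
by rewrite addnS !seriesSr mulrDr addrA lerD.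
Qed.

(** The binomial coefficient is Gamma(k + j) / (j! Gamma(k)) for 0 < k.  For
    k = 0, where this quotient has no meaning, the predecessor makes it 1 at
    j = 0 and 0 at 0 < j; this is the convention for which the convolution
    identity below holds from k = 0 on. *)
Definition ml_term {R : realType} (nu z : R) (k : nat) (b : R) (j : nat) (x : R) : R :=
  'C((k + j).-1, j)%:R * z ^+ j * power_kernel (nu * j%:R + b) x.

(** On the positive half-line this is x^(b - 1) E^k_{nu,b}(z x^nu) for 0 < k.  It
    is locked so that unification does not unfold the limit. *)
HB.lock Definition ml_kernel {R : realType} (nu z : R) (k : nat) (b x : R) : R :=
  limn (series (fun j => ml_term nu z k b j x)).

Section mittag_leffler_kernel.
Context {R : realType} (nu : R).
Hypothesis nu0 : 0 < nu.
Local Notation mu := (@lebesgue_measure R).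
Implicit Types (z b x : R) (k j : nat).

Local Notation ml_term := (@ml_term R nu).
Local Notation ml_kernel := (@ml_kernel R nu).

Let index_gt0 b j : 0 < b -> 0 < nu * j%:R + b.
Proof. by move=> b0; rewrite ltr_wpDl// mulr_ge0// ltW. Qed.

Lemma bin_le_exp2 n m : ('C(n, m) <= 2 ^ n)%N.
Proof.
have [nm|mn] := ltnP n m; first by rewrite bin_small.
rewrite -[2%N]/(1 + 1)%N expnDn (bigD1 (Ordinal (mn : m < n.+1)%N))//=.
by rewrite !exp1n !muln1 leq_addr.
Qed.

Lemma ml_term_ge0 z k b j x : 0 < b -> 0 <= z -> 0 <= ml_term z k b j x.
Proof.
by move=> b0 z0; rewrite !mulr_ge0 ?exprn_ge0 ?power_kernel_ge0 ?index_gt0.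
Qed.

Lemma norm_ml_term z k b j x : 0 < b ->
  `|ml_term z k b j x| = ml_term `|z| k b j x.
Proof.
move=> b0; rewrite /ml_term !normrM normrX normr_nat.
by rewrite (ger0_norm (power_kernel_ge0 _ _))// index_gt0.
Qed.

(** By the lower bound on Gamma with a well-chosen A, the kernel of order
    nu j + b decreases faster than any prescribed geometric sequence, in
    particular fast enough to beat the factor (2 |z|)^j. *)
Lemma ml_term_le_geometric z k b x : 0 < b ->
  exists C : R, forall j, ml_term `|z| k b j x <= C * 2^-1 ^+ j.
Proof.
move=> b0; have [x0|x0] := leP x 0.
  by exists 0 => j; rewrite /ml_term power_kernel_le0// mulr0 mul0r.
(* A is such that (x / A)^nu = 1 / q, and then 2 |z| / q <= 1 / 2. *)
pose q : R := 4 * (`|z| + 1).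
have q0 : 0 < q by rewrite mulr_gt0// ltr_wpDl.
pose A := x * q `^ nu^-1.
have A0 : 0 < A by rewrite mulr_gt0// powR_gt0.
pose D := (A + 1) * expR (A + 1).
have D0 : 0 < D by rewrite mulr_gt0 ?expR_gt0// addr_gt0.
exists (2 ^+ k * (x / A) `^ b * (D / x)) => j.
have bj := index_gt0 j b0.
have ker : power_kernel (nu * j%:R + b) x <= (x / A) `^ b * q^-1 ^+ j * (D / x).
  rewrite /power_kernel x0.
  have -> : x `^ (nu * j%:R + b - 1) = x `^ (nu * j%:R + b) / x.
    by rewrite powRB ?powRr1 ?(ltW x0)//; apply/implyP => _; rewrite gt_eqF.
  have AD : 0 < A `^ (nu * j%:R + b) / D by rewrite divr_gt0 ?powR_gt0.
  have GA : A `^ (nu * j%:R + b) / D <= Gamma (nu * j%:R + b).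
    apply: le_trans (Gamma_ge bj A0).
    by rewrite /D invfM expRN [(A + 1)^-1 * _]mulrC.
  apply: (@le_trans _ _ (x `^ (nu * j%:R + b) / x / (A `^ (nu * j%:R + b) / D))).
    rewrite ler_wpM2l ?divr_ge0 ?powR_ge0 ?(ltW x0)//.
    by rewrite lef_pV2 ?posrE// (lt_le_trans AD).
  have -> : (x / A) `^ b * q^-1 ^+ j = x `^ (nu * j%:R + b) / A `^ (nu * j%:R + b).
    have -> : q^-1 = (x / A) `^ nu.
      have -> : x / A = q `^ (- nu^-1).
        by rewrite /A invfM mulVKf ?gt_eqF// powRN.
      by rewrite -powRrM mulNr mulVf ?gt_eqF// powR_inv1// ltW.
    rewrite -powR_mulrn ?powR_ge0// -powRrM -powRD; last first.
      by apply/implyP => _; rewrite gt_eqF// divr_gt0.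
    rewrite addrC powRM ?(ltW x0) ?invr_ge0 ?(ltW A0)//; congr (_ * _).
    by rewrite -powR_inv1 ?(ltW A0)// -powRrM mulN1r powRN.
  by rewrite [X in _ / X]mulrC invfM invrK le_eqVlt; apply/orP; left; apply/eqP; ring.
apply: (@le_trans _ _ (2 ^+ (k + j) * `|z| ^+ j *
    ((x / A) `^ b * q^-1 ^+ j * (D / x)))).
  apply: ler_pM => //.
  - exact: power_kernel_ge0.
  rewrite ler_wpM2r ?exprn_ge0// -natrX ler_nat.
  by apply: leq_trans (bin_le_exp2 _ _) _; rewrite leq_exp2l// leq_pred.
have -> : 2 ^+ (k + j) * `|z| ^+ j * ((x / A) `^ b * q^-1 ^+ j * (D / x)) =
    2 ^+ k * (x / A) `^ b * (D / x) * (2 * `|z| * q^-1) ^+ j.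
  by rewrite exprD !exprMn; ring.
have Dx : 0 <= D / x by rewrite divr_ge0 ?(ltW D0) ?(ltW x0).
apply: ler_wpM2l; first by rewrite mulr_ge0// mulr_ge0 ?exprn_ge0 ?powR_ge0.
rewrite lerXn2r ?nnegrE ?mulr_ge0 ?invr_ge0 ?(ltW q0)//.
rewrite ler_pdivrMr// /q; have := normr_ge0 z; lra.
Qed.

Lemma is_cvg_ml_kernel_norm z k b x : 0 < b ->
  cvgn (series (fun j => ml_term `|z| k b j x)).
Proof.
move=> b0; have [C hC] := ml_term_le_geometric z k x b0.
apply: (@series_le_cvg _ _ (geometric C 2^-1)) => //.
- by move=> j; rewrite ml_term_ge0.
- by move=> j; apply: le_trans (hC j); rewrite ml_term_ge0.
- by apply: is_cvg_geometric_series; rewrite ger0_norm ?invr_ge0// invf_lt1// ltr1n.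
Qed.

Let norm_ml_series z k b x : 0 < b ->
  [normed series (fun j => ml_term z k b j x)] =
  series (fun j => ml_term `|z| k b j x).
Proof.
by move=> b0; congr series; apply/funext => j /=; rewrite norm_ml_term.
Qed.

Lemma is_cvg_ml_kernel z k b x : 0 < b ->
  cvgn (series (fun j => ml_term z k b j x)).
Proof.
move=> b0; apply: normed_cvg; rewrite norm_ml_series//.
exact: is_cvg_ml_kernel_norm.
Qed.

Lemma cvg_ml_kernel z k b x : 0 < b ->
  series (fun j => ml_term z k b j x) @ \oo --> ml_kernel z k b x.
Proof. by move=> b0; rewrite ml_kernel.unlock; exact: is_cvg_ml_kernel. Qed.

Lemma norm_ml_kernel_le z k b x : 0 < b ->
  `|ml_kernel z k b x| <= ml_kernel `|z| k b x.
Proof.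
move=> b0; rewrite ml_kernel.unlock -norm_ml_series//.
by apply: lim_series_norm; rewrite norm_ml_series//; exact: is_cvg_ml_kernel_norm.
Qed.

Lemma measurable_ml_term z k b j : measurable_fun setT (ml_term z k b j).
Proof. by apply: measurable_funM => //; exact: measurable_power_kernel. Qed.

Lemma measurable_ml_kernel z k b : 0 < b ->
  measurable_fun setT (ml_kernel z k b).
Proof.
move=> b0; apply: (@measurable_fun_cvg _ _ _ setT
    (fun n x => series (fun j => ml_term z k b j x) n)) => [n|x _].
  by apply: measurable_sum => j; exact: measurable_ml_term.
exact: cvg_ml_kernel.
Qed.

Lemma ml_kernel0 z b x : 0 < b -> ml_kernel z 0 b x = power_kernel b x.
Proof.
move=> b0; rewrite ml_kernel.unlock; apply: lim_near_cst => //; near=> n.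
have n0 : (0 < n)%N by near: n; exact: nbhs_infty_gt.
rewrite /series/= big_ltn// big_nat big1 => [|[//|j] _].
  by rewrite /ml_term bin0 expr0 mulr0 add0r !mul1r addr0.
by rewrite /ml_term add0n bin_small// !mul0r.
Unshelve. all: by end_near. Qed.

(** Pascal's rule on the coefficients. *)
Lemma ml_kernelS z k b x : 0 < b ->
  ml_kernel z k.+1 b x = ml_kernel z k b x + z * ml_kernel z k.+1 (b + nu) x.
Proof.
move=> b0; have bn0 : 0 < b + nu by rewrite addr_gt0.
have step n : series (fun j => ml_term z k.+1 b j x) n.+1 =
    series (fun j => ml_term z k b j x) n.+1 +
    z * series (fun j => ml_term z k.+1 (b + nu) j x) n.
  apply: series_pascal => [|j]; first by rewrite /ml_term !bin0.
  rewrite /ml_term addSn addnS/= binS natrD.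
  have -> : nu * j%:R + (b + nu) = nu * j.+1%:R + b.
    by rewrite -natr1; ring.
  by rewrite exprS; ring.
have c1 : (series (fun j => ml_term z k.+1 b j x) n.+1 @[n --> \oo] -->
    ml_kernel z k.+1 b x).
  have := @cvg_ml_kernel z k.+1 b x b0.
  by rewrite -(cvg_shiftS (series _)).
have c2 : (series (fun j => ml_term z k b j x) n.+1 +
    z * series (fun j => ml_term z k.+1 (b + nu) j x) n @[n --> \oo] -->
    ml_kernel z k b x + z * ml_kernel z k.+1 (b + nu) x).
  apply: cvgD; last by apply: cvgMr; exact: cvg_ml_kernel.
  have := @cvg_ml_kernel z k b x b0.
  by rewrite -(cvg_shiftS (series _)).
rewrite -(cvg_lim (@Rhausdorff R) c2) -(cvg_lim (@Rhausdorff R) c1).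
by congr (limn _); exact/funext.
Qed.

Lemma ml_kernel_unroll z k b x J : 0 < b ->
  ml_kernel z k.+1 b x =
    series (fun j => z ^+ j * ml_kernel z k (b + nu * j%:R) x) J +
    z ^+ J * ml_kernel z k.+1 (b + nu * J%:R) x.
Proof.
move=> b0; elim: J => [|J IHJ].
  by rewrite /series/= big_geq// add0r expr0 mul1r mulr0 addr0.
rewrite IHJ seriesSr -addrA; apply: (congr1 (+%R _)).
rewrite ml_kernelS; last by rewrite ltr_wpDr// mulr_ge0// ltW.
by rewrite mulrDr exprSr -mulrA -natr1 mulrDr mulr1 addrA.
Qed.

(** The coefficient C(k + n, n) of the remainder after J steps is at most
    C(k + J + n, J + n), so that the remainder is bounded by the tail of the
    series of absolute values. *)
Lemma ml_kernel_tail z k b x J : 0 < b ->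
  `|z| ^+ J * ml_kernel `|z| k.+1 (b + nu * J%:R) x <=
  ml_kernel `|z| k.+1 b x - series (fun j => ml_term `|z| k.+1 b j x) J.
Proof.
move=> b0.
have bJ : 0 < b + nu * J%:R by rewrite ltr_wpDr// mulr_ge0// ltW.
have cJ : `|z| ^+ J * series (fun j => ml_term `|z| k.+1 (b + nu * J%:R) j x) n
    @[n --> \oo] --> `|z| ^+ J * ml_kernel `|z| k.+1 (b + nu * J%:R) x.
  by apply: cvgMr; exact: cvg_ml_kernel.
rewrite -(cvg_lim (@Rhausdorff R) cJ).
apply: limr_le; first by apply/cvg_ex; eexists; exact: cJ.
apply: nearW => n /=; rewrite lerBrDl.
apply: (@le_trans _ _ (series (fun j => ml_term `|z| k.+1 b j x) (J + n)%N)); last first.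
  rewrite ml_kernel.unlock; apply: nondecreasing_cvgn_le; last exact: is_cvg_ml_kernel.
  by apply: nondecreasing_series => i _ _; exact: ml_term_ge0.
apply: series_shift_le => {}n.
rewrite /ml_term mulrA [`|z| ^+ J * (_ * _)]mulrCA -exprD.
have -> : nu * n%:R + (b + nu * J%:R) = nu * (J + n)%:R + b.
  by rewrite natrD; ring.
rewrite !ler_wpM2r ?exprn_ge0 ?power_kernel_ge0 ?index_gt0// ler_nat !addSn/=.
rewrite -(bin_sub (leq_addl k n)) addnK -(bin_sub (leq_addl k (J + n))) addnK.
by rewrite leq_bin2l// leq_add2l leq_addl.
Qed.

(** Pascal's rule, iterated, in the limit: this sums over the second factor the
    convolutions of the kernel of index k with the terms of the kernel of index
    1, without rearranging a double series. *)
Lemma cvg_ml_kernel_series z k b x : 0 < b ->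
  series (fun j => z ^+ j * ml_kernel z k (b + nu * j%:R) x) @ \oo -->
  ml_kernel z k.+1 b x.
Proof.
move=> b0.
pose rem J := z ^+ J * ml_kernel z k.+1 (b + nu * J%:R) x.
have -> : series (fun j => z ^+ j * ml_kernel z k (b + nu * j%:R) x) =
    fun J => ml_kernel z k.+1 b x - rem J.
  by apply/funext => J; rewrite (ml_kernel_unroll z k x J b0) addrK.
rewrite -[X in _ --> X]subr0; apply: cvgB; first exact: cvg_cst.
apply/norm_cvg0P.
apply: (@squeeze_cvgr _ _ _ _ (cst 0)
  (fun J => ml_kernel `|z| k.+1 b x - series (fun j => ml_term `|z| k.+1 b j x) J)).
- apply: nearW => J; rewrite normr_ge0/= /rem normrM normrX.
  apply: le_trans (ml_kernel_tail _ _ _ _ b0).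
  rewrite ler_wpM2l ?exprn_ge0//; apply: norm_ml_kernel_le.
  by rewrite ltr_wpDr// mulr_ge0// ltW.
- exact: cvg_cst.
- rewrite -(subrr (ml_kernel `|z| k.+1 b x)); apply: cvgB; first exact: cvg_cst.
  exact: cvg_ml_kernel.
Qed.

End mittag_leffler_kernel.

(** * Convolution of Mittag-Leffler kernels *)

(** Dominated convergence, where the dominating function is the sum of the
    absolute values; it is integrable since its integral is at most the sum of
    the c j. *)
Lemma integral_series_dominated d (T : measurableType d) (R : realType)
    (mu : {measure set T -> \bar R}) (u : nat -> T -> R) (U : T -> R)
    (v c : R^nat) (l : R) :
  (forall j, mu.-integrable setT (EFin \o u j)) ->
  (forall j, (\int[mu]_x (u j x)%:E = (v j)%:E)%E) ->
  (forall j, (\int[mu]_x `|(u j x)%:E| <= (c j)%:E)%E) ->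
  cvgn (series c) ->
  measurable_fun setT U ->
  (forall x, series (fun j => u j x) @ \oo --> U x) ->
  series v @ \oo --> l ->
  mu.-integrable setT (EFin \o U) /\ (\int[mu]_x (U x)%:E = l%:E)%E.
Proof.
move=> iu uv uc cc mU uU vl.
have mu_ j : measurable_fun setT (EFin \o u j) := measurable_int _ (iu j).
have mabs j : measurable_fun setT (fun x => `|(u j x)%:E|%E).
  exact: (@measurableT_comp _ _ _ _ _ _ (@abse R) _ (EFin \o u j)).
pose G x := (\sum_(j <oo) `|(u j x)%:E|)%E.
have mG : measurable_fun setT G by apply: ge0_emeasurable_sum.
have G0 x : (0 <= G x)%E by apply: nneseries_ge0.
have iG : mu.-integrable setT G.
  apply/integrableP; split => //.
  under eq_integral do rewrite gee0_abs//.
  rewrite /G integral_nneseries//.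
  apply: (@le_lt_trans _ _ (\sum_(j <oo) (c j)%:E)%E).
    by apply: lee_nneseries => // j _ _; exact: integral_ge0.
  have /cvg_ex[C hC] := cc.
  rewrite (_ : (\sum_(j <oo) (c j)%:E)%E = C%:E) ?ltry//.
  apply/cvg_lim => //.
  rewrite (_ : (fun n => _) = EFin \o series c); last first.
    by apply/funext => n /=; rewrite /series/= sumEFin.
  by apply: cvg_EFin; [exact: nearW|].
have mS n : measurable_fun setT (fun x => (series (fun j => u j x) n)%:E).
  apply/measurable_EFinP; apply: measurable_sum => j.
  exact/measurable_EFinP.
have [iU _ cI] : [/\ mu.-integrable setT (EFin \o U),
  (\int[mu]_x `|(series (fun j => u j x) n)%:E - (U x)%:E|)%E @[n --> \oo] --> 0%E &
  (\int[mu]_x (series (fun j => u j x) n)%:E)%E @[n --> \oo] -->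
    (\int[mu]_x (U x)%:E)%E].
  apply: (@dominated_convergence _ _ _ mu setT measurableT _ _ G) => //.
  - exact/measurable_EFinP.
  - apply: aeW => x _ /=; apply: cvg_EFin; first exact: nearW.
    exact: uU.
  - apply: aeW => x n _ /=.
    apply: (@le_trans _ _ (\sum_(0 <= j < n) `|u j x|)%:E).
      by rewrite lee_fin; exact: ler_norm_sum.
    by rewrite -sumEFin; exact: nneseries_lim_ge.
split => //; apply: cvg_unique cI _ => //.
rewrite (_ : (fun n => _) = EFin \o series v).
  by apply: cvg_EFin; [exact: nearW|].
apply/funext => n /=; rewrite /series/= -sumEFin.
under eq_integral do rewrite -sumEFin.
by rewrite integral_sum//; apply: eq_bigr.
Qed.

Section kernel_convolution.
Context {R : realType}.
Local Notation mu := (@lebesgue_measure R).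

(** The kernels may take negative values, so a convolution is only meaningful
    together with its absolute convergence. *)
Definition convolves_to (f g : R -> R) (x v : R) : Prop :=
  mu.-integrable setT (fun y => (f (x - y) * g y)%:E) /\
  (\int[mu]_y (f (x - y) * g y)%:E = v%:E)%E.

Lemma measurable_convolution (f g : R -> R) (x : R) :
  measurable_fun setT f -> measurable_fun setT g ->
  measurable_fun setT (fun y : R => f (x - y) * g y).
Proof.
move=> mf mg; apply: measurable_funM => //.
by apply: measurableT_comp => //; exact: measurable_funB.
Qed.

Lemma ge0_convolves_to (f g : R -> R) (x v : R) :
  measurable_fun setT f -> measurable_fun setT g ->
  (forall y, 0 <= f y) -> (forall y, 0 <= g y) ->
  (\int[mu]_y (f (x - y) * g y)%:E = v%:E)%E -> convolves_to f g x v.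
Proof.
move=> mf mg f0 g0 fgv; split => //; apply/integrableP; split.
  by apply/measurable_EFinP; exact: measurable_convolution.
under eq_integral do rewrite gee0_abs ?lee_fin ?mulr_ge0//.
by rewrite fgv ltry.
Qed.

Lemma power_kernel_convolves (a b x : R) : 0 < a -> 0 < b ->
  convolves_to (power_kernel a) (power_kernel b) x (power_kernel (a + b) x).
Proof.
move=> a0 b0; apply: ge0_convolves_to.
- exact: measurable_power_kernel.
- exact: measurable_power_kernel.
- by move=> y; exact: power_kernel_ge0.
- by move=> y; exact: power_kernel_ge0.
- by under eq_integral do rewrite EFinM; rewrite power_kernel_convolution.
Qed.

Lemma convolves_toZl (f g : R -> R) (x v s : R) :
  convolves_to f g x v -> convolves_to (fun y => s * f y) g x (s * v).
Proof.
move=> [fgi fgv].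
have E : (fun y => (s * f (x - y) * g y)%:E) =
    (fun y => s%:E * (f (x - y) * g y)%:E)%E.
  by apply/funext => y; rewrite -EFinM mulrA.
by split; rewrite E; [exact: integrableZl|rewrite integralZl// fgv].
Qed.

Lemma convolves_toZr (f g : R -> R) (x v s : R) :
  convolves_to f g x v -> convolves_to f (fun y => s * g y) x (s * v).
Proof.
move=> [fgi fgv].
have E : (fun y => (f (x - y) * (s * g y))%:E) =
    (fun y => s%:E * (f (x - y) * g y)%:E)%E.
  by apply/funext => y; rewrite -EFinM mulrCA.
by split; rewrite E; [exact: integrableZl|rewrite integralZl// fgv].
Qed.

Lemma convolves_to_norm_le (f g F G : R -> R) (x v : R) :
  measurable_fun setT f -> measurable_fun setT g ->
  (forall y, `|f y| <= F y) -> (forall y, `|g y| <= G y) ->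
  convolves_to F G x v ->
  (\int[mu]_y `|(f (x - y) * g y)%:E| <= v%:E)%E.
Proof.
move=> mf mg fF gG [iFG <-]; apply: ge0_le_integral => //.
- apply: measurableT_comp => //.
  by apply/measurable_EFinP; exact: measurable_convolution.
- exact: measurable_int iFG.
- by move=> y _; rewrite lee_fin normrM ler_pM.
Qed.

End kernel_convolution.

Section mittag_leffler_convolution.
Context {R : realType} (nu : R).
Hypothesis nu0 : 0 < nu.
Local Notation mu := (@lebesgue_measure R).
Local Notation term := (@ml_term R nu).
Local Notation kernel := (@ml_kernel R nu).

Let index_gt0 b j : 0 < b -> 0 < nu * j%:R + b.
Proof. by move=> b0; rewrite ltr_wpDl// mulr_ge0// ltW. Qed.

(** Beta's integral, term by term.  The domination comes from the same identity
    between the terms at |z|, whose series converges. *)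
Lemma ml_kernel_convolves_power z k b c x : 0 < b -> 0 < c ->
  convolves_to (kernel z k b) (power_kernel c) x (kernel z k (b + c) x).
Proof.
move=> b0 c0; have bc0 : 0 < b + c by rewrite addr_gt0.
have mc : measurable_fun setT (@power_kernel R c) := measurable_power_kernel c.
have term_conv (z' : R) j :
    convolves_to (term z' k b j) (power_kernel c) x (term z' k (b + c) j x).
  have := @power_kernel_convolves _ (nu * j%:R + b) c x (index_gt0 j b0) c0.
  by move/(convolves_toZl ('C((k + j).-1, j)%:R * z' ^+ j)); rewrite -addrA.
apply: (@integral_series_dominated _ _ _ mu
    (fun j y => term z k b j (x - y) * power_kernel c y) _
    (fun j => term z k (b + c) j x) (fun j => term `|z| k (b + c) j x)).
- by move=> j; case: (term_conv z j).
- by move=> j; case: (term_conv z j).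
- move=> j; apply: (@convolves_to_norm_le _ _ _ (term `|z| k b j) (power_kernel c)).
  + exact: measurable_ml_term.
  + exact: mc.
  + by move=> y; rewrite norm_ml_term.
  + by move=> y; rewrite ger0_norm// power_kernel_ge0.
  + exact: term_conv.
- exact: is_cvg_ml_kernel_norm.
- by apply: measurable_convolution => //; exact: measurable_ml_kernel.
- move=> y.
  rewrite (_ : series _ = (fun n => series (fun j => term z k b j (x - y)) n *
      power_kernel c y)); last first.
    by apply/funext => n; rewrite /series/= mulr_suml.
  by apply: cvgMl; exact: cvg_ml_kernel.
- exact: cvg_ml_kernel.
Qed.

(** The second kernel is expanded into power kernels, against which the first
    one is already known to convolve to a kernel of index k; these add up to the
    kernel of index k + 1 by Pascal's rule.  Domination is again the identity at
    |z|. *)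
Lemma ml_kernel_convolves z k b c x : 0 < b -> 0 < c ->
  convolves_to (kernel z k b) (kernel z 1 c) x (kernel z k.+1 (b + c) x).
Proof.
move=> b0 c0; have bc0 : 0 < b + c by rewrite addr_gt0.
have term1 (z' : R) j y : term z' 1 c j y = z' ^+ j * power_kernel (nu * j%:R + c) y.
  by rewrite /ml_term add1n/= binn mul1r.
have mk (z' : R) : measurable_fun setT (kernel z' k b) by apply: measurable_ml_kernel.
have term_conv (z' : R) j :
    convolves_to (kernel z' k b) (term z' 1 c j) x
      (z' ^+ j * kernel z' k (b + c + nu * j%:R) x).
  have := @ml_kernel_convolves_power z' k b (nu * j%:R + c) x b0 (index_gt0 j c0).
  move/(convolves_toZr (z' ^+ j)).
  have -> : b + (nu * j%:R + c) = b + c + nu * j%:R by ring.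
  suff -> : term z' 1 c j = (fun y => z' ^+ j * power_kernel (nu * j%:R + c) y) by [].
  by apply/funext => y; rewrite term1.
apply: (@integral_series_dominated _ _ _ mu
    (fun j y => kernel z k b (x - y) * term z 1 c j y) _
    (fun j => z ^+ j * kernel z k (b + c + nu * j%:R) x)
    (fun j => `|z| ^+ j * kernel `|z| k (b + c + nu * j%:R) x)).
- by move=> j; case: (term_conv z j).
- by move=> j; case: (term_conv z j).
- move=> j; apply: (@convolves_to_norm_le _ _ _ (kernel `|z| k b) (term `|z| 1 c j)).
  + exact: mk.
  + exact: measurable_ml_term.
  + by move=> y; exact: norm_ml_kernel_le.
  + by move=> y; rewrite norm_ml_term.
  + exact: term_conv.
- by apply/cvg_ex; eexists; exact: cvg_ml_kernel_series.
- by apply: measurable_convolution => //; exact: measurable_ml_kernel.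
- move=> y.
  rewrite (_ : series _ = (fun n => kernel z k b (x - y) *
      series (fun j => term z 1 c j y) n)); last first.
    by apply/funext => n; rewrite /series/= mulr_sumr.
  by apply: cvgMr; exact: cvg_ml_kernel.
- exact: cvg_ml_kernel_series.
Qed.

Lemma ml_kernel_le0 z k b x : x <= 0 -> kernel z k b x = 0.
Proof.
move=> x0; rewrite ml_kernel.unlock (_ : series _ = cst 0) ?lim_cst//.
apply/funext => n; rewrite /series/= big1// => j _.
by rewrite /ml_term power_kernel_le0// mulr0.
Qed.

Lemma ml_kernelE z k b x : 0 < b -> 0 < x ->
  kernel z k.+1 b x =
  x `^ (b - 1) * mittag_leffler k.+1%:R nu b (z * x `^ nu).
Proof.
move=> b0 x0; rewrite ml_kernel.unlock /mittag_leffler.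
set u := (fun j => _ / _).
have E j : term z k.+1 b j x = x `^ (b - 1) * u j.
  rewrite /ml_term /u /power_kernel x0 -natrD addSn !Gamma_nat/=.
  have -> : nu * j%:R + b - 1 = b - 1 + nu * j%:R by ring.
  rewrite powRD; last by rewrite (gt_eqF x0) implybT.
  rewrite powRrM (powR_mulrn _ (powR_ge0 _ _)) exprMn.
  have /(congr1 (fun n => n%:R : R)) := bin_fact (leq_addl k j).
  rewrite addnK !natrM => <-.
  have f1 : (k`!%:R : R) != 0 by rewrite pnatr_eq0 -lt0n fact_gt0.
  have f2 : (j`!%:R : R) != 0 by rewrite pnatr_eq0 -lt0n fact_gt0.
  have f3 : Gamma (nu * j%:R + b) != 0 by rewrite gt_eqF// Gamma_gt0// index_gt0.
  by field; rewrite f1 f2 f3.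
have c := @is_cvg_ml_kernel _ _ nu0 z k.+1 b x b0.
have E2 : (fun j => term z k.+1 b j x) = x `^ (b - 1) *: u by apply/funext.
have xb : x `^ (b - 1) != 0 by rewrite gt_eqF// powR_gt0.
have cu : cvgn (series u).
  have -> : u = (x `^ (b - 1))^-1 *: (fun j => term z k.+1 b j x).
    by rewrite E2 scalerA mulVf// scale1r.
  exact: is_cvg_seriesZ.
by rewrite E2 lim_seriesZ.
Qed.

End mittag_leffler_convolution.

(** * Independence of past and future interarrival times *)

Section sub_law.
Context d (T : measurableType d) (R : realType) (P : probability T R).

Definition sub_law (E : set T) (mE : measurable E) (U : {mfun T >-> R}) :
  set R -> \bar R := pushforward (mrestr P mE) U.

Variables (E : set T) (mE : measurable E) (U : {mfun T >-> R}).

Let sub_law0 : sub_law mE U set0 = 0%E.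
Proof. exact: measure0. Qed.

Let sub_law_ge0 A : (0 <= sub_law mE U A)%E.
Proof. exact: measure_ge0. Qed.

Let sub_law_sigma_additive : semi_sigma_additive (sub_law mE U).
Proof. exact: measure_semi_sigma_additive. Qed.

HB.instance Definition _ := isMeasure.Build _ _ _ (sub_law mE U)
  sub_law0 sub_law_ge0 sub_law_sigma_additive.

Let sub_law_fin : fin_num_fun (sub_law mE U).
Proof.
move=> A mA; apply: fin_num_measure.
by rewrite -[X in measurable X]setTI; exact: measurable_funP.
Qed.

HB.instance Definition _ := @Measure_isFinite.Build _ _ _ (sub_law mE U) sub_law_fin.

Lemma ge0_integral_sub_law (f : R -> \bar R) :
  measurable_fun setT f -> (forall x, (0 <= f x)%E) ->
  (\int[sub_law mE U]_x f x = \int[P]_w ((\1_E w)%:E * f (U w)))%E.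
Proof.
move=> mf f0; rewrite ge0_integral_pushforward//.
rewrite preimage_setT (@ge0_integral_density _ _ _ P _ (\1_E))//.
- by move=> A mA; rewrite integral_indic// setIC.
- by apply: measurableT_comp => //; exact: measurable_funP.
- by move=> w; exact: f0.
Qed.

Variables (F : set T) (mF : measurable F) (V : {mfun T >-> R}) (c : {nonneg R}).

(** The hypothesis is the conclusion for rectangles C, and a finite measure on
    the plane is determined by its values on rectangles.  The constant c is the
    probability of the event F that is carried along. *)
Lemma joint_law :
  (forall B D, measurable B -> measurable D ->
    P ((E `&` F) `&` (U @^-1` B `&` V @^-1` D)) =
    (c%:num%:E * (P (E `&` U @^-1` B) * P (V @^-1` D)))%E) ->
  forall C : set (R * R), measurable C ->
    P ((E `&` F) `&` [set w | C (U w, V w)]) =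
    (c%:num%:E * (sub_law mE U \x distribution P V) C)%E.
Proof.
move=> rect C mC.
have mEF : measurable (E `&` F) by apply: measurableI.
have mUV : measurable_fun setT (fun w => (U w, V w)).
  exact: measurable_fun_pair.
have H1 := @product_measure_unique _ _ _ _ _ (sub_law mE U)
  (mscale c (distribution P V)) (pushforward (mrestr P mEF) (mfun_of mUV)).
have H2 := @product_measure_unique _ _ _ _ _ (sub_law mE U)
  (mscale c (distribution P V)) (mscale c (sub_law mE U \x distribution P V)%E).
transitivity ((sub_law mE U \x mscale c (distribution P V))%E C).
  rewrite (H1 mUV)//; first by rewrite /pushforward/= /mrestr setIC.
  move=> B D mB mD.
  change (P ((U @^-1` B `&` V @^-1` D) `&` (E `&` F)) =
    (P (U @^-1` B `&` E) * (c%:num%:E * P (V @^-1` D)))%E).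
  by rewrite [U @^-1` B `&` E]setIC muleCA -rect// setIC.
rewrite H2// => B D mB mD.
transitivity (c%:num%:E * (sub_law mE U \x distribution P V) (B `*` D))%E => //.
by rewrite product_measure1E// muleCA.
Qed.

End sub_law.

Section arrivals.
Context d (T : measurableType d) (R : realType) (P : probability T R).
Variable X : nat -> {RV P >-> R}.
Local Notation mu := (@lebesgue_measure R).
Implicit Types (n m : nat) (E : set T) (C : set (R * R)).

Definition arrival n (w : T) : R := \sum_(i < n) X i w.

Lemma arrivalS n w : arrival n.+1 w = arrival n w + X n w.
Proof. by rewrite /arrival big_ord_recr. Qed.

Lemma measurable_arrival n : measurable_fun setT (arrival n).
Proof. by apply: measurable_sum => i; exact: measurable_funP. Qed.

Local Notation arrivalm n := (mfun_of (measurable_arrival n)).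

(** Independence from the sequence X n, X n.+1, ... is tested on finite families,
    as for mutual independence; this avoids generating sigma-algebras. *)
Definition independent_of_future n E : Prop :=
  forall (J : seq nat) (B : nat -> set R), uniq J ->
    (forall i, i \in J -> (n <= i)%N) -> (forall i, measurable (B i)) ->
    P (E `&` \bigcap_(i in [set` J]) (X i @^-1` B i)) =
      (P E * \prod_(i <- J) P (X i @^-1` B i))%E.

(** The events E of the past may be intersected with any condition on the time
    of the n-th event: this is what makes E independent of the future jointly
    with [arrival n], and it is stable under the passage from n to n + 1. *)
Definition adapted n E : Prop := measurable E /\
  forall B, measurable B -> independent_of_future n (E `&` arrival n @^-1` B).

(** For rectangles C this is adaptedness, X n being counted in the future.  The
    later X i are carried along in order to make the next event of the past
    adapted in its turn. *)
Lemma adapted_future_joint n E (mE : measurable E) J (B : nat -> set R) C :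
  adapted n E -> uniq J -> (forall i, i \in J -> (n < i)%N) ->
  (forall i, measurable (B i)) -> measurable C ->
  P ((E `&` \bigcap_(i in [set` J]) (X i @^-1` B i)) `&`
      [set w | C (arrival n w, X n w)]) =
    (\prod_(i <- J) P (X i @^-1` B i) *
      (sub_law P mE (arrivalm n) \x distribution P (X n)) C)%E.
Proof.
move=> [_ aE] uJ nJ mB mC.
have mXB i (D : set R) : measurable D -> measurable (X i @^-1` D).
  by move=> mD; rewrite -[X in measurable X]setTI; exact: measurable_funP.
set F := \bigcap_(i in _) _.
have mF : measurable F by apply: bigcap_measurableType => i _; exact: mXB.
pose p : \bar R := (\prod_(i <- J) P (X i @^-1` B i))%E.
have p0 : (0 <= p)%E by apply: prode_ge0 => i _.
have pfin : p \is a fin_num.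
  by apply: prode_fin_num => i _; rewrite fin_num_measure//; exact: mXB.
pose c := NngNum (fine_ge0 p0).
have pE : p = c%:num%:E by rewrite /= fineK.
rewrite -/p pE; apply: (joint_law mE mF) => // A D mA mD; rewrite -pE.
(* X n itself is part of the future of time n: its constraint D joins B. *)
pose B' i := if i == n then D else B i.
have B'J i : i \in J -> B' i = B i.
  by move=> /nJ ni; rewrite /B' gtn_eqF.
have B'n : B' n = D by rewrite /B' eqxx.
have -> : arrivalm n @^-1` A = arrival n @^-1` A by [].
have := aE A mA (n :: J) B'; rewrite big_cons/= uJ andbT B'n.
rewrite (_ : _ `&` _ = E `&` F `&` (arrival n @^-1` A `&` X n @^-1` D)).
  move=> ->.
  - rewrite [RHS]muleC -muleA; congr (_ * (_ * _))%E.
    by rewrite /p big_seq [RHS]big_seq; apply: eq_bigr => i /B'J ->.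
  - by apply/negP => /nJ; rewrite ltnn.
  - by move=> i; rewrite inE => /predU1P[->//|/nJ/ltnW].
  - by move=> i; rewrite /B'; case: ifP.
apply/seteqP; split => w /=.
  move=> [[Ew Aw] FDw]; split; split => //.
    move=> i /= iJ; have := FDw i; rewrite /= inE iJ orbT B'J//; exact.
  by have := FDw n; rewrite /= inE eqxx B'n; exact.
move=> [[Ew Fw] [Aw Dw]]; split => // i; rewrite /= inE => /predU1P[->|iJ].
  by rewrite B'n.
by rewrite B'J//; exact: Fw.
Qed.

Lemma adapted_joint n E (mE : measurable E) C :
  adapted n E -> measurable C ->
  P (E `&` [set w | C (arrival n w, X n w)]) =
    (sub_law P mE (arrivalm n) \x distribution P (X n))%E C.
Proof.
move=> aE mC; have := @adapted_future_joint n E mE [::] (fun=> setT) C aE.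
by rewrite big_nil mul1e set_nil bigcap_set0 setIT; apply.
Qed.

Lemma adaptedS n E C : adapted n E -> measurable C ->
  adapted n.+1 (E `&` [set w | C (arrival n w, X n w)]).
Proof.
move=> aE mC; have [mE _] := aE.
have mSX : measurable_fun setT (fun w => (arrival n w, X n w)).
  by apply: measurable_fun_pair => //; exact: measurable_arrival.
split=> [|B mB J A uJ nJ mA].
  by apply: measurableI => //; rewrite -[X in measurable X]setTI; exact: mSX.
pose C' : set (R * R) := C `&` [set z | B (z.1 + z.2)].
have mC' : measurable C'.
  apply: measurableI => //; rewrite -[X in measurable X]setTI.
  by apply: (measurable_funD (f := fst) (g := snd)).
rewrite (_ : E `&` _ `&` arrival n.+1 @^-1` B = E `&` [set w | C' (arrival n w, X n w)]); last first.
  rewrite -setIA; congr (_ `&` _); apply/seteqP.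
  by split => w /=; rewrite arrivalS.
rewrite (adapted_joint mE)// setIAC.
by rewrite (adapted_future_joint mE)// muleC.
Qed.

Lemma adapted_cut n E B : adapted n E -> measurable B ->
  adapted n (E `&` arrival n @^-1` B).
Proof.
move=> [mE aE] mB; split=> [|A mA].
  apply: measurableI => //; rewrite -[X in measurable X]setTI.
  exact: measurable_arrival.
by rewrite -setIA -preimage_setI; apply: aE; exact: measurableI.
Qed.

Lemma adapted0 : mutually_independent X -> adapted 0 setT.
Proof.
move=> iX; split => // B _ J A uJ _ mA; rewrite setTI.
have arr0 w : arrival 0 w = 0 by rewrite /arrival big_ord0.
have [B0|B0] := pselect (B 0).
  rewrite (_ : _ @^-1` B = setT); last by apply/seteqP; split => // w _ /=; rewrite arr0.
  by rewrite setTI probability_setT mul1e iX.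
rewrite (_ : _ @^-1` B = set0); last by apply/seteqP; split => // w /=; rewrite arr0.
by rewrite set0I measure0 mul0e.
Qed.

(** Conditional expectation of phi([arrival n], X n) given the past: as X n is
    independent of it, [arrival n] may be held fixed while integrating over
    X n. *)
Lemma freezing n E (phi : R * R -> \bar R) : adapted n E ->
  measurable_fun setT phi -> (forall z, (0 <= phi z)%E) ->
  (\int[P]_w ((\1_E w)%:E * phi (arrival n w, X n w)) =
   \int[P]_w ((\1_E w)%:E *
     \int[distribution P (X n)]_x phi (arrival n w, x)))%E.
Proof.
move=> aE mphi phi0; have [mE _] := aE.
have mSX : measurable_fun setT (fun w => (arrival n w, X n w)).
  by apply: measurable_fun_pair => //; exact: measurable_arrival.
transitivity (\int[pushforward (mrestr P mE) (mfun_of mSX)]_z phi z)%E.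
  rewrite ge0_integral_pushforward// preimage_setT.
  rewrite [RHS](@ge0_integral_density _ _ _ P _ (\1_E))//.
  - by move=> A mA; rewrite integral_indic// setIC.
  - exact: measurableT_comp.
  - by move=> w; exact: phi0.
rewrite (eq_measure_integral
  (sub_law P mE (arrivalm n) \x distribution P (X n))%E); last first.
  move=> C mC _; transitivity (P (E `&` [set w | C (arrival n w, X n w)])).
    by rewrite /pushforward /mrestr /= setIC.
  exact: adapted_joint.
rewrite fubini_tonelli1//.
apply: (@ge0_integral_sub_law _ _ _ P _ mE (arrivalm n)
  (fun u => \int[distribution P (X n)]_x phi (u, x))%E).
- exact: (measurable_fun_fubini_tonelli_F phi).
- by move=> x; exact: integral_ge0.
Qed.

End arrivals.

(** * Renewals after a given event *)

Lemma ge0_integral_lebesgue_density d (T : measurableType d) (R : realType)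
    (P : probability T R) (Y : {RV P >-> R}) (F : R -> R) (f : R -> \bar R) :
  measurable_fun setT F ->
  (forall A : set R, measurable A ->
    distribution P Y A = (\int[@lebesgue_measure R]_(x in A) (F x)%:E)%E) ->
  measurable_fun setT f -> (forall x, (0 <= f x)%E) ->
  (\int[distribution P Y]_x f x =
   \int[@lebesgue_measure R]_x ((F x)%:E * f x))%E.
Proof.
move=> mF YF mf f0.
(* The Borel sets of R and those on which Lebesgue measure is defined are the
   same sets, carried by two different structures. *)
have mY : measurable_fun setT (Y : T -> measurableTypeR R).
  have mY0 : measurable_fun setT (Y : T -> R) by exact: measurable_funP.
  exact: mY0.
rewrite -(@ge0_integral_density _ _ R (@lebesgue_measure R)
  (distribution P (mfun_of mY)))//.
by rewrite !ge0_integral_pushforward.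
Qed.

Section renewal.
Context d (T : measurableType d) (R : realType) (P : probability T R).
Variables (X : nat -> {RV P >-> R}) (F : R -> R).
Local Notation mu := (@lebesgue_measure R).
Hypotheses (mF : measurable_fun setT F) (F0 : forall x, 0 <= F x).
Hypothesis XF : forall n (A : set R), measurable A ->
  distribution P (X n) A = (\int[mu]_(x in A) (F x)%:E)%E.
Implicit Types (n m k : nat) (E : set T).

Lemma freezing_density n E (phi : R * R -> \bar R) : adapted X n E ->
  measurable_fun setT phi -> (forall z, (0 <= phi z)%E) ->
  (\int[P]_w ((\1_E w)%:E * phi (arrival X n w, X n w)) =
   \int[P]_w ((\1_E w)%:E *
     \int[mu]_x ((F x)%:E * phi (arrival X n w, x))))%E.
Proof.
move=> aE mphi phi0; rewrite freezing//; apply: eq_integral => w _.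
apply: (congr1 (mule _)).
apply: (ge0_integral_lebesgue_density (f := fun x => phi (arrival X n w, x))) => //.
- exact: XF.
- exact: measurableT_comp.
Qed.

(** The probability that a renewal process started afresh, with interarrival
    density F, has exactly m renewals up to time u, defined by conditioning on
    the first one.  The base case is 0 for u < 0: this discards the paths on
    which the last renewal to be counted comes too late. *)
Fixpoint renewal_prob m (u : R) : \bar R :=
  if m is m'.+1 then (\int[mu]_x ((F x)%:E * renewal_prob m' (u - x)%R))%E
  else (\int[mu]_x ((F x)%:E * (\1_[set z : R * R | 0 <= z.1 < z.2] (u, x))%:E))%E.

Lemma renewal_prob_ge0 m u : (0 <= renewal_prob m u)%E.
Proof.
elim: m u => [|m IHm] u /=; apply: integral_ge0 => x _.
  by rewrite mule_ge0 ?lee_fin.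
by rewrite mule_ge0 ?lee_fin.
Qed.

Let measurable_waiting : measurable [set z : R * R | 0 <= z.1 < z.2].
Proof.
have -> : [set z : R * R | 0 <= z.1 < z.2] =
    (fun z : R * R => (0 <= z.1) && (z.1 < z.2)) @^-1` [set true] by [].
rewrite -[X in measurable X]setTI.
apply: (_ : measurable_fun _ _) => //.
by apply: measurable_and; [exact: measurable_fun_ler|exact: measurable_fun_ltr].
Qed.

Let mF2 : measurable_fun setT (fun z : R * R => (F z.2)%:E).
Proof. by apply/measurable_EFinP; exact: measurableT_comp. Qed.

Lemma measurable_renewal_prob m : measurable_fun setT (renewal_prob m).
Proof.
elim: m => [|m IHm] /=.
  apply: (@measurable_fun_fubini_tonelli_F _ _ _ _ _ mu (fun z : R * R =>
    ((F z.2)%:E * (\1_[set z : R * R | 0 <= z.1 < z.2] z)%:E)%E)).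
    by apply: emeasurable_funM => //; exact/measurable_EFinP/measurable_indic.
  by move=> z; rewrite mule_ge0 ?lee_fin.
apply: (@measurable_fun_fubini_tonelli_F _ _ _ _ _ mu (fun z : R * R =>
    ((F z.2)%:E * renewal_prob m (z.1 - z.2)%R)%E)).
  apply: emeasurable_funM => //; apply: measurableT_comp => //.
  exact: measurable_funB.
by move=> z; rewrite mule_ge0 ?lee_fin// renewal_prob_ge0.
Qed.

(** Renewal property: after the n-th event the process starts afresh.  The
    induction moves n forward, the event E of the past being enlarged at each
    step. *)
Lemma prob_renewals m n E (t : R) : adapted X n E ->
  P (E `&` [set w | arrival X (n + m) w <= t < arrival X (n + m).+1 w]) =
  (\int[P]_w ((\1_E w)%:E * renewal_prob m (t - arrival X n w)))%E.
Proof.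
elim: m n E => [|m IHm] n E aE; have [mE _] := aE.
  pose C : set (R * R) := [set z | z.1 <= t < z.1 + z.2].
  have mC : measurable C.
    have -> : C = (fun z : R * R => (t - z.1, z.2)) @^-1`
        [set z : R * R | 0 <= z.1 < z.2].
      by apply/seteqP; split => z; rewrite /C/= subr_ge0 ltrBlDl.
    rewrite -[X in measurable X]setTI.
    suff : measurable_fun setT (fun z : R * R => (t - z.1, z.2)) by apply.
    by apply: measurable_fun_pair => //; exact: measurable_funB.
  have mEC : measurable (E `&` [set w | C (arrival X n w, X n w)]).
    by have [] := adaptedS aE mC.
  rewrite addn0 (_ : [set w | _] = [set w | C (arrival X n w, X n w)]); last first.
    by apply/seteqP; split => w; rewrite /C/= arrivalS.
  rewrite -[LHS](_ : \int[P]_w (\1_(E `&` [set w | C (arrival X n w, X n w)]) w)%:E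
      = _)%E; last by rewrite integral_indic// setIT.
  transitivity (\int[P]_w ((\1_E w)%:E * (\1_C (arrival X n w, X n w))%:E))%E.
    by apply: eq_integral => w _; rewrite indicI.
  rewrite (@freezing_density n E (fun z => (\1_C z)%:E) aE); last 2 first.
  - by apply/measurable_EFinP; exact: measurable_indic.
  - by move=> z; rewrite lee_fin.
  apply: eq_integral => w _; congr (_ * _)%E.
  apply: eq_integral => x _; congr (_ * _%:E)%E; rewrite !indicE.
  suff -> : ((arrival X n w, x) \in C) =
    ((t - arrival X n w, x) \in [set z : R * R | 0 <= z.1 < z.2]) by [].
  by apply/idP/idP; rewrite !inE /C/= subr_ge0 ltrBlDl.
rewrite (_ : [set w | _] = [set w | arrival X (n.+1 + m) w <= t < arrival X (n.+1 + m).+1 w]); last first.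
  by rewrite addSnnS.
rewrite IHm; last first.
  have := adaptedS aE measurableT.
  by rewrite (_ : [set w | _] = setT) ?setIT//; apply/seteqP; split.
transitivity (\int[P]_w ((\1_E w)%:E *
    renewal_prob m (t - (arrival X n w + X n w))%R))%E.
  by apply: eq_integral => w _; rewrite arrivalS.
rewrite (@freezing_density n E (fun z => renewal_prob m (t - (z.1 + z.2))%R) aE).
- by apply: eq_integral => w _ /=; under eq_integral do rewrite opprD addrA.
- apply: measurableT_comp; first exact: measurable_renewal_prob.
  by apply: measurable_funB => //; exact: measurable_funD.
- by move=> z; exact: renewal_prob_ge0.
Qed.

End renewal.

(** * Null sets and counting *)

Section null_sets.
Context {R : realType}.
Local Notation mu := (@lebesgue_measure R).

Lemma ae_reflect (x : R) (Q : R -> Prop) :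
  {ae mu, forall y, Q y} -> {ae mu, forall y, Q (x - y)}.
Proof.
move=> [N [mN N0 QN]].
have mS : measurable_fun setT ((fun y => x - y) : R -> R) by exact: measurable_funB.
exists ((fun y => x - y) @^-1` N); split.
- by rewrite -[X in measurable X]setTI; exact: (mS measurableT).
- have mS1 : measurable_fun setT ((fun y => y + x) : R -> R) by exact: measurable_funD.
  have mN1 : measurable ((fun y => y + x) @^-1` N : set R).
    by rewrite -[X in measurable X]setTI; exact: (mS1 measurableT).
  have := lebesgue_measureN mN1.
  rewrite /pushforward -comp_preimage (_ : _ \o _ = (fun y => x - y)); last first.
    by apply/funext => y /=; rewrite addrC.
  move=> ->; have := @lebesgue_measure_affine R (PosNum ltr01) x N mN.
  rewrite /= mul1e => NE; rewrite -[RHS]N0 NE; congr (mu (_ @^-1` N)).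
  by apply/funext => y; rewrite mul1r.
- by move=> y /= Qy; apply: QN.
Qed.

Lemma ae_neq (x : R) : {ae mu, forall y, y != x}.
Proof.
exists [set x]; split; first exact: measurable_set1.
- exact: lebesgue_measure_set1.
- by move=> y /= /negP; rewrite negbK => /eqP.
Qed.

(** Makes the filter lemmas applicable to almost everywhere statements about
    Lebesgue measure. *)
#[global] Instance ae_lebesgue_filter :
  Filter (almost_everywhere (mu : set R -> \bar R)).
Proof. exact: (ae_filter_ringOfSetsType mu). Qed.

End null_sets.

Lemma measurable_counting d (T : measurableType d) (R : realType)
    (B : nat -> set T) : (forall n, measurable (B n)) ->
  measurable_fun setT (fun w => counting [set n | B n w] : \bar R).
Proof.
move=> mB.
rewrite (_ : (fun w => _) = (fun w => \sum_(n <oo) (\1_(B n) w)%:E)%E).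
  apply: ge0_emeasurable_sum => //.
  by move=> n _; apply/measurable_EFinP/measurable_indic.
apply/funext => w; rewrite counting_dirac; apply: eq_eseriesr => n _.
by rewrite diracE indicE; congr (_%:R%:E); apply/idP/idP; rewrite !inE.
Qed.

(** S n.+1 is the time of the event of index n, so the events counted are those
    of index smaller than k exactly when S k is the last term up to u. *)
Lemma counting_partial_sums (R : realType) (S : R^nat) (u : R) (k : nat) :
  S 0%N <= u -> {homo S : i j / (i <= j)%N >-> i <= j} ->
  counting [set n | S n.+1 <= u] = k%:R%:E :> \bar R <-> S k <= u < S k.+1.
Proof.
move=> S0 ndS.
have cI n : counting (`I_n) = n%:R%:E :> \bar R.
  by rewrite /counting asboolT ?finite_II// (@card_fset_set _ _ n).
pose A := [set n | S n.+1 <= u]; rewrite -/A.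
split=> [|/andP[Sk Sk1]].
  move=> cE; apply/andP; split.
    rewrite leNgt; apply/negP => uSk.
    have k0 : (0 < k)%N by rewrite lt0n; apply: contraTneq uSk => ->; rewrite -leNgt.
    have sub : A `<=` `I_k.-1.
      move=> n /= Sn; rewrite ltnNge; apply/negP => kn.
      have : S k <= u by apply: le_trans Sn; apply: ndS; rewrite -(prednK k0) ltnS.
      by rewrite leNgt uSk.
    have : (counting A <= counting (`I_k.-1) :> \bar R)%E.
      by apply: le_measure => //; rewrite inE.
    by rewrite cE cI lee_fin ler_nat -ltnS prednK// ltnn.
  rewrite ltNge; apply/negP => Sk.
  have sub : `I_k.+1 `<=` A.
    by move=> n /= nk; apply: le_trans Sk; exact: ndS.
  have : (counting (`I_k.+1) <= counting A :> \bar R)%E.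
    by apply: le_measure => //; rewrite inE.
  by rewrite cE cI lee_fin ler_nat ltnn.
rewrite (_ : A = `I_k) ?cI//.
apply/seteqP; split => n /=.
  move=> Sn; rewrite ltnNge; apply/negP => kn.
  have : S k.+1 <= u by apply: le_trans Sn; apply: ndS.
  by rewrite leNgt Sk1.
by move=> nk; apply: le_trans Sk; exact: ndS.
Qed.

(** * Densities of the fractional Poisson process *)

Section fractional_poisson_analysis.
Context {R : realType} (lambda nu : R).
Hypotheses (lambda0 : 0 < lambda) (nu0 : 0 < nu).
Local Notation mu := (@lebesgue_measure R).
Local Notation q := (@ml_kernel R nu (- lambda)).
Implicit Types (k m : nat).

(** The positive part costs nothing, as the kernel is almost everywhere
    nonnegative, and makes Tonelli's theorem applicable without restriction. *)
Definition interarrival_density (x : R) : R := Num.max 0 (lambda * q 1 nu x).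
Local Notation F := interarrival_density.

Lemma interarrival_density_ge0 x : 0 <= F x.
Proof. by rewrite le_max lexx. Qed.

Let mq k b : 0 < b -> measurable_fun setT (q k b).
Proof. exact: measurable_ml_kernel. Qed.

Lemma measurable_interarrival_density : measurable_fun setT F.
Proof.
by apply: measurable_maxr => //; apply: measurable_funM => //; exact: mq.
Qed.

Lemma fpp_densityE x : 0 < x -> fpp_density lambda nu x = lambda * q 1 nu x.
Proof. by move=> x0; rewrite /fpp_density ml_kernelE// -mulrA. Qed.

Section law.
Context d (T : measurableType d) (P : probability T R) (Y : {RV P >-> R}).
Hypothesis dY : has_positive_density Y (fpp_density lambda nu).

Let law_kernel (A : set R) : measurable A ->
  distribution P Y A = (\int[mu]_(x in A) (lambda * q 1 nu x)%:E)%E.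
Proof.
move=> mA; rewrite dY// integral_mkcondr; apply: eq_integral => x _.
rewrite /patch mem_setE in_itv/= andbT.
by case: ltP => x0; [rewrite fpp_densityE|rewrite ml_kernel_le0// mulr0].
Qed.

(** The nonnegativity of y^(nu - 1) E_{nu,nu}(- lambda y^nu) is not apparent on the
    alternating series.  It is deduced here from the fact that lambda times this
    kernel integrates to a probability over every Borel set, in particular over
    the set where it is negative. *)
Lemma ae_kernel1_ge0 : {ae mu, forall x, 0 <= q 1 nu x}.
Proof.
pose g x := (lambda * q 1 nu x)%:E.
have mg : measurable_fun setT g.
  by apply/measurable_EFinP; apply: measurable_funM => //; exact: mq.
pose N := [set x : R | q 1 nu x < 0].
have mN : measurable N.
  rewrite (_ : N = q 1 nu @^-1` `]-oo, 0[%classic).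
    by rewrite -[X in measurable X]setTI; exact: mq.
  by apply/seteqP; split => x; rewrite /N/= in_itv.
have gN : (\int[mu]_(x in N) `|g x| = 0)%E.
  apply/eqP; rewrite eq_le integral_ge0// andbT.
  have <- : (- (\int[mu]_(x in N) g x) = \int[mu]_(x in N) `|g x|)%E.
    transitivity (- \int[mu]_(x in N) (- `|g x|))%E; last first.
      by rewrite integral_ge0N// oppeK.
    apply: (congr1 (fun u : \bar R => (- u)%E)).
    apply: eq_integral => x /set_mem qx.
    by rewrite lte0_abs ?oppeK// lte_fin pmulr_rlt0.
  by rewrite oppe_le0 -(law_kernel mN); exact: measure_ge0.
have [M [mM M0 NM]] := (ae_eq_integral_abs mu mN (measurable_funTS mg)).1 gN.
exists M; split => // x /= /negP; rewrite -ltNge => qx.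
apply: NM => /= /(_ qx) /eqP; rewrite eqe mulf_eq0 gt_eqF//=.
by rewrite lt_eqF.
Qed.

Lemma law_interarrival (A : set R) : measurable A ->
  distribution P Y A = (\int[mu]_(x in A) (F x)%:E)%E.
Proof.
move=> mA; rewrite law_kernel//; apply: ae_eq_integral => //.
- apply/measurable_EFinP/measurable_funTS.
  by apply: measurable_funM => //; exact: mq.
- apply/measurable_EFinP; apply: measurable_funTS.
  exact: measurable_interarrival_density.
- apply: filterS ae_kernel1_ge0 => x qx _; congr EFin.
  by rewrite /F; apply/esym/max_idPr; rewrite mulr_ge0// ltW.
Qed.

End law.

Hypothesis kernel1_ge0 : {ae mu, forall x, 0 <= q 1 nu x}.

Let index_gt0 k : 0 < nu * k.+1%:R.
Proof. by rewrite mulr_gt0. Qed.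

(** A convolution of almost everywhere nonnegative kernels. *)
Lemma ae_kernel_ge0 k : {ae mu, forall x, 0 <= q k.+1 (nu * k.+1%:R) x}.
Proof.
elim: k => [|k IHk]; first by rewrite mulr1.
apply: aeW => x.
have [_ ] := @ml_kernel_convolves R nu nu0 (- lambda) k.+1 _ nu x (index_gt0 k) nu0.
have -> : nu * k.+1%:R + nu = nu * k.+2%:R by rewrite -[k.+2%:R]natr1 mulrDr mulr1.
move=> qE; rewrite -lee_fin -qE.
pose p k (b y : R) : R := Num.max 0 (q k b y).
have mp j b : 0 < b -> measurable_fun setT (p j b).
  by move=> b0; apply: measurable_maxr => //; exact: mq.
rewrite (@ae_eq_integral _ _ _ mu setT (fun y =>
  (p k.+1 (nu * k.+1%:R) (x - y) * p 1 nu y)%:E))//.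
- by apply: integral_ge0 => y _; rewrite lee_fin mulr_ge0// le_max lexx.
- by apply/measurable_EFinP; apply: measurable_convolution; exact: mq.
- by apply/measurable_EFinP; apply: measurable_convolution; exact: mp.
- apply: filterS2 kernel1_ge0 (ae_reflect x IHk) => y q1 qk _.
  have p1 : p 1 nu y = q 1 nu y by rewrite /p max_r.
  have pk : p k.+1 (nu * k.+1%:R) (x - y) = q k.+1 (nu * k.+1%:R) (x - y).
    by rewrite /p max_r.
  by rewrite p1 pk.
Qed.

(** The index k stands for k + 1 interarrival times: the sum of none has no
    density. *)
Definition arrival_density k (x : R) : R :=
  Num.max 0 (lambda ^+ k.+1 * q k.+1 (nu * k.+1%:R) x).

Lemma arrival_density_ge0 k x : 0 <= arrival_density k x.
Proof. by rewrite le_max lexx. Qed.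

Lemma measurable_arrival_density k : measurable_fun setT (arrival_density k).
Proof.
by apply: measurable_maxr => //; apply: measurable_funM => //; exact: mq.
Qed.

Lemma arrival_density_ae k : {ae mu, forall x,
  arrival_density k x = lambda ^+ k.+1 * q k.+1 (nu * k.+1%:R) x}.
Proof.
apply: filterS (ae_kernel_ge0 k) => x qx.
by rewrite /arrival_density max_r// mulr_ge0// exprn_ge0// ltW.
Qed.

(** The convolution of the kernels of indices k + 1 and 1, in which each density
    may replace its kernel because they agree almost everywhere. *)
Lemma arrival_densityS k x :
  (\int[mu]_y ((arrival_density k (x - y))%:E * (F y)%:E) =
   (arrival_density k.+1 x)%:E)%E.
Proof.
have [_] := @ml_kernel_convolves R nu nu0 (- lambda) k.+1 _ nu x (index_gt0 k) nu0.
have -> : nu * k.+1%:R + nu = nu * k.+2%:R by rewrite -[k.+2%:R]natr1 mulrDr mulr1.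
move=> qE.
have DE : (\int[mu]_y ((arrival_density k (x - y))%:E * (F y)%:E) =
    (lambda ^+ k.+2 * q k.+2 (nu * k.+2%:R) x)%:E)%E.
  rewrite [RHS]EFinM -qE -integralZl//; last first.
    by have [] := @ml_kernel_convolves R nu nu0 (- lambda) k.+1 _ nu x (index_gt0 k) nu0.
  apply: ae_eq_integral => //.
  - apply: emeasurable_funM; apply/measurable_EFinP.
      apply: measurableT_comp; first exact: measurable_arrival_density.
      exact: measurable_funB.
    exact: measurable_interarrival_density.
  - apply: emeasurable_funM => //; apply/measurable_EFinP.
    by apply: measurable_convolution; exact: mq.
  - apply: filterS2 kernel1_ge0 (ae_reflect x (arrival_density_ae k)) => y q1 Dk _.
    rewrite Dk /F (@max_r _ _ 0); last by rewrite mulr_ge0// ltW.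
    by rewrite -!EFinM; congr EFin; rewrite [in RHS]exprSr mulrACA.
rewrite DE; congr EFin; rewrite /arrival_density max_r// -lee_fin -DE.
apply: integral_ge0 => y _.
by rewrite mule_ge0// lee_fin ?arrival_density_ge0 ?interarrival_density_ge0.
Qed.

(** For m = 0, the probability that the first event occurs after time u is 1
    minus the integral of F up to u, that is 1 - lambda q_{1,1+nu}(u); this is
    q_{1,1}(u) by Pascal's rule, as q_{0,1} = 1 on the positive half-line.  Each
    further renewal is a convolution with F.  At u = 0 the kernel vanishes by
    convention, but the probability of no renewal is 1. *)
Lemma renewal_prob_kernel m u : u != 0 -> (\int[mu]_x (F x)%:E = 1)%E ->
  renewal_prob F m u = (lambda ^+ m * q m.+1 (nu * m%:R + 1) u)%:E.
Proof.
move=> u0 F1; elim: m u u0 => [|m IHm] u u0.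
  rewrite mulr0 add0r expr0 mul1r /=.
  have [u_gt0|u_le0] := ltP 0 u; last first.
    have u_lt0 : u < 0 by rewrite lt_neqAle u0.
    rewrite ml_kernel_le0// integral0_eq// => x _.
    rewrite indicE memNset ?mule0//=.
    by move=> /andP[/(lt_le_trans u_lt0)]; rewrite ltxx.
  have [_ qE] := @ml_kernel_convolves R nu nu0 (- lambda) 0 1 nu u ltr01 nu0.
  have q_le : (\int[mu]_x ((F x)%:E * (\1_[set y | y <= u] x)%:E) =
      (lambda * q 1 (1 + nu) u)%:E)%E.
    rewrite EFinM -qE -integralZl//; last first.
      by have [] := @ml_kernel_convolves R nu nu0 (- lambda) 0 1 nu u ltr01 nu0.
    apply: ae_eq_integral => //.
    - apply: emeasurable_funM; apply/measurable_EFinP.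
        exact: measurable_interarrival_density.
      apply: measurable_indic.
      by rewrite (_ : [set y | y <= u] = `]-oo, u]%classic).
    - apply: emeasurable_funM => //; apply/measurable_EFinP.
      by apply: measurable_convolution; exact: mq.
    - apply: filterS2 kernel1_ge0 (ae_neq u) => y q1 yu _.
      rewrite /F (@max_r _ _ 0); last by rewrite mulr_ge0// ltW.
      rewrite ml_kernel0// indicE -!EFinM; congr EFin.
      have [yu_lt|yu_ge] := ltP y u.
        by rewrite power_kernel1 ?subr_gt0// mem_set/= ?mulr1 ?mul1r// ltW.
      rewrite power_kernel_le0 ?subr_le0// mul0r mulr0 memNset ?mulr0//=.
      by apply/negP; rewrite -ltNge lt_neqAle eq_sym yu.
  (* The first event occurs either after u or not. *)
  have split1 : (\int[mu]_x ((F x)%:E * (\1_[set z : R * R | (0 <= z.1 < z.2)%R] (u, x))%:E)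
      + \int[mu]_x ((F x)%:E * (\1_[set y | (y <= u)%R] x)%:E) = 1)%E.
    rewrite -ge0_integralD//.
    - rewrite -[RHS]F1; apply: eq_integral => x _.
      rewrite -ge0_muleDr ?lee_fin// -EFinD.
      rewrite !indicE.
      have [ux|xu] := ltP u x.
        rewrite mem_set/= ?(ltW u_gt0)// memNset ?addr0 ?mule1//=.
        by apply/negP; rewrite -ltNge.
      rewrite memNset/= ?mem_set ?add0r ?mule1//=.
      by rewrite ltNge xu andbF.
    - by move=> x _; rewrite mule_ge0 ?lee_fin ?interarrival_density_ge0.
    - apply: emeasurable_funM; apply/measurable_EFinP.
        exact: measurable_interarrival_density.
      rewrite (_ : (fun x => _) = \1_(`]u, +oo[%classic : set R)).
        exact: measurable_indic.
      apply/funext => x; rewrite !indicE; congr (_%:R); congr nat_of_bool.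
      by apply/idP/idP; rewrite !inE/= in_itv/= (ltW u_gt0) andbT.
    - by move=> x _; rewrite mule_ge0 ?lee_fin ?interarrival_density_ge0.
    - apply: emeasurable_funM; apply/measurable_EFinP.
        exact: measurable_interarrival_density.
      by rewrite (_ : [set y | y <= u] = `]-oo, u]%classic).
  rewrite ml_kernelS// ml_kernel0// power_kernel1// mulNr EFinB -q_le -split1.
  by rewrite addeK// q_le.
rewrite /= (_ : nu * m.+1%:R + 1 = nu * m%:R + 1 + nu); last first.
  by rewrite -natr1; ring.
have b0 : 0 < nu * m%:R + 1 by rewrite ltr_wpDl// mulr_ge0// ltW.
have [iq qE] := @ml_kernel_convolves R nu nu0 (- lambda) m.+1 _ nu u b0 nu0.
rewrite [RHS]EFinM -qE -integralZl//.
apply: ae_eq_integral => //.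
- apply: emeasurable_funM.
    by apply/measurable_EFinP; exact: measurable_interarrival_density.
  apply: measurableT_comp; last exact: measurable_funB.
  apply: measurable_renewal_prob; first exact: measurable_interarrival_density.
  exact: interarrival_density_ge0.
- apply: emeasurable_funM => //; exact: measurable_int iq.
- apply: filterS2 kernel1_ge0 (ae_neq u) => x q1 xu _.
  rewrite IHm ?subr_eq0 1?eq_sym// /F (@max_r _ _ 0); last by rewrite mulr_ge0// ltW.
  by rewrite -!EFinM; congr EFin; rewrite exprS; ring.
Qed.

End fractional_poisson_analysis.

(** * Joint law of two counts *)

Lemma integral_prob_cst d (T : measurableType d) (R : realType)
    (P : probability T R) (v : \bar R) : (\int[P]_w v = v)%E.
Proof.
transitivity (v * P setT)%E; first exact: integral_cst.
by rewrite probability_setT mule1.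
Qed.

Section bivariate.
Context d (T : measurableType d) (R : realType) (P : probability T R).
Variables (X : nat -> {RV P >-> R}) (lambda nu : R).
Local Notation mu := (@lebesgue_measure R).
Hypotheses (lambda0 : 0 < lambda) (nu0 : 0 < nu).
Hypothesis iX : mutually_independent X.
Hypothesis dX : forall n, has_positive_density (X n) (fpp_density lambda nu).
Local Notation q := (@ml_kernel R nu (- lambda)).
Local Notation F := (interarrival_density lambda nu).
Implicit Types (n k m : nat).

Let mF : measurable_fun setT F := measurable_interarrival_density lambda nu0.
Let F0 : forall x, 0 <= F x := interarrival_density_ge0 lambda nu.
Let XF n := law_interarrival lambda0 nu0 (dX n).
Let q1 : {ae mu, forall x, 0 <= q 1 nu x} := ae_kernel1_ge0 lambda0 nu0 (dX 0).

Let integral_F : (\int[mu]_x (F x)%:E = 1)%E.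
Proof. by rewrite -(XF 0 measurableT) probability_setT. Qed.

Let index_gt0 m : 0 < nu * m%:R + 1.
Proof. by rewrite ltr_wpDl// mulr_ge0// ltW. Qed.

Lemma adaptedT n : adapted X n setT.
Proof.
elim: n => [|n IHn]; first exact: adapted0.
have := adaptedS IHn measurableT.
by rewrite (_ : [set w | _] = setT) ?setIT//; apply/seteqP; split.
Qed.

(** The density of a sum of independent variables is the convolution of their
    densities; independence enters through [freezing_density]. *)
Lemma integral_arrival k (phi : R -> \bar R) :
  measurable_fun setT phi -> (forall x, (0 <= phi x)%E) ->
  (\int[P]_w phi (arrival X k.+1 w) =
   \int[mu]_x ((arrival_density lambda nu k x)%:E * phi x))%E.
Proof.
move=> mphi phi0.
have step n (f : R -> \bar R) : measurable_fun setT f -> (forall x, (0 <= f x)%E) ->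
    (\int[P]_w f (arrival X n.+1 w) =
     \int[P]_w \int[mu]_x ((F x)%:E * f (arrival X n w + x)%R))%E.
  move=> mf f0.
  transitivity (\int[P]_w ((\1_[set: T] w)%:E * f (arrival X n w + X n w)%R))%E.
    by apply: eq_integral => w _; rewrite indicT mul1e arrivalS.
  rewrite (@freezing_density _ _ _ P X F mF XF n setT (fun z => f (z.1 + z.2))).
  - by apply: eq_integral => w _; rewrite indicT mul1e.
  - exact: adaptedT.
  - by apply: measurableT_comp => //; exact: measurable_funD.
  - by move=> z; exact: f0.
elim: k phi mphi phi0 => [|k IHk] phi mphi phi0.
  rewrite step//.
  transitivity (\int[P]_w \int[mu]_x ((F x)%:E * phi x))%E.
    apply: eq_integral => w _; apply: eq_integral => x _.
    by rewrite /arrival big_ord0 add0r.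
  rewrite integral_prob_cst; apply: eq_integral => x _; congr (_%:E * _)%E.
  by rewrite /arrival_density /interarrival_density expr1 mulr1.
rewrite step// (IHk (fun u => \int[mu]_x ((F x)%:E * phi (u + x)%R)))%E; last 2 first.
- apply: (@measurable_fun_fubini_tonelli_F _ _ _ _ _ mu (fun z : R * R =>
    ((F z.2)%:E * phi (z.1 + z.2)%R)%E)).
    apply: emeasurable_funM.
      by apply/measurable_EFinP; exact: measurableT_comp.
    by apply: measurableT_comp => //; exact: measurable_funD.
  by move=> z; rewrite mule_ge0 ?lee_fin.
- by move=> u; apply: integral_ge0 => x _; rewrite mule_ge0 ?lee_fin.
rewrite ge0_integral_convolution//; first last.
- by move=> x; rewrite lee_fin arrival_density_ge0.
- exact/measurable_EFinP.
- by apply/measurable_EFinP; exact: measurable_arrival_density.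
by apply: eq_integral => v _; rewrite arrival_densityS// muleC.
Qed.

Let kernel_ge0 m u : 0 <= q m.+1 (nu * m%:R + 1) u.
Proof.
have [->|u0] := eqVneq u 0; first by rewrite ml_kernel_le0.
have := renewal_prob_ge0 F0 m u.
rewrite (renewal_prob_kernel lambda0 nu0 q1)// lee_fin pmulr_rge0//.
by rewrite exprn_gt0.
Qed.

(** The density of [arrival X k.+1] is put into the form of the printed kernel.
    The integral over [0, s] is insensitive to the endpoints, so only the
    values of M' inside matter; there the powers and the Mittag-Leffler series
    have their intended meaning. *)
Lemma integral_arrival_itv k (s : R) (M M' : R -> \bar R) :
  measurable_fun setT M -> (forall x, (0 <= M x)%E) ->
  (forall w, 0 < w < s -> M' w = M w) ->
  (\int[P]_w ((\1_[set x | (x <= s)%R] (arrival X k.+1 w))%:E * M (arrival X k.+1 w)) =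
   (lambda ^+ k.+1)%:E * \int[mu]_(w in `[0%R, s])
     ((w `^ (nu * k.+1%:R - 1) *
       mittag_leffler k.+1%:R nu (nu * k.+1%:R) (- lambda * w `^ nu))%:E * M' w))%E.
Proof.
move=> mM M0 MM'.
pose c x : R := Num.max 0 (q k.+1 (nu * k.+1%:R) x).
have b0 : 0 < nu * k.+1%:R by rewrite mulr_gt0.
have mq : measurable_fun setT (q k.+1 (nu * k.+1%:R)) by apply: measurable_ml_kernel.
have mc : measurable_fun setT c by apply: measurable_maxr.
have c0 x : 0 <= c x by rewrite le_max lexx.
have mle : measurable [set x : R | x <= s].
  by rewrite (_ : [set x : R | x <= s] = `]-oo, s]%classic).
have m1 : measurable_fun setT (fun x : R => (\1_[set y : R | y <= s] x)%:E : \bar R).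
  by apply/measurable_EFinP; exact: measurable_indic.
rewrite (@integral_arrival k (fun x => (\1_[set y : R | (y <= s)%R] x)%:E * M x)%E); last 2 first.
- exact: emeasurable_funM.
- by move=> x; rewrite mule_ge0// lee_fin.
transitivity ((lambda ^+ k.+1)%:E * \int[mu]_x ((c x)%:E * ((\1_[set y : R | (y <= s)%R] x)%:E * M x)))%E.
  rewrite -ge0_integralZl_EFin//.
  - apply: eq_integral => x _; rewrite [RHS]muleA -EFinM; congr (_%:E * _)%E.
    by rewrite /c maxr_pMr ?mulr0// exprn_ge0// ltW.
  - by move=> x _; rewrite !mule_ge0// lee_fin.
  - apply: emeasurable_funM; first exact/measurable_EFinP.
    exact: emeasurable_funM.
  - by rewrite exprn_ge0// ltW.
congr (_ * _)%E.
have E w : 0 < w < s ->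
    ((w `^ (nu * k.+1%:R - 1) *
      mittag_leffler k.+1%:R nu (nu * k.+1%:R) (- lambda * w `^ nu))%:E * M' w =
     (q k.+1 (nu * k.+1%:R) w)%:E * M w)%E.
  by move=> /[dup] /MM' -> /andP[w0 _]; rewrite ml_kernelE.
have mqM (D : set R) : measurable_fun D (fun w => (q k.+1 (nu * k.+1%:R) w)%:E * M w)%E.
  by apply: measurable_funTS; apply: emeasurable_funM => //; exact/measurable_EFinP.
rewrite (@integral_itv_bndoo R 0 s _ true false); last first.
  apply: eq_measurable_fun (mqM _) => w; rewrite inE/= in_itv/= => ws.
  by rewrite E.
transitivity (\int[mu]_(w in `]0%R, s[) ((q k.+1 (nu * k.+1%:R) w)%:E * M w))%E; last first.
  by apply: eq_integral => w; rewrite inE/= in_itv/= => /E.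
rewrite [RHS]integral_mkcond; apply: ae_eq_integral => //.
- apply: emeasurable_funM; first exact/measurable_EFinP.
  exact: emeasurable_funM.
- by apply/(measurable_restrictT (fun w => (q k.+1 (nu * k.+1%:R) w)%:E * M w)%E).
- apply: filterS2 (ae_kernel_ge0 nu0 q1 k) (ae_neq s) => x qx xs _.
  rewrite /patch mem_setE in_itv/= indicE.
  have cx : c x = q k.+1 (nu * k.+1%:R) x by exact/max_idPr.
  have [x0|x0] := ltP 0 x; last first.
    by rewrite /c ml_kernel_le0// maxxx mul0e.
  have [xs_lt|xs_ge] := ltP x s.
    by rewrite mem_set ?mul1e ?cx//= ltW.
  rewrite memNset ?mul0e ?mule0//=.
  by apply/negP; rewrite -ltNge lt_neqAle eq_sym xs.
Qed.

Let c1 (y : R) : R := Num.max 0 (q 1 nu y).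

Let measurable_c1 : measurable_fun setT c1.
Proof. by apply: measurable_maxr => //; exact: measurable_ml_kernel. Qed.

Let c1_ge0 y : 0 <= c1 y.
Proof. by rewrite le_max lexx. Qed.

(** Given that some event occurs at time w <= s, and up to the factor
    lambda^(m + 1): the probability that the next one occurs after s, at a time
    w + y, and that exactly m others follow until t. *)
Definition later_arrivals (s t : R) m (w : R) : \bar R :=
  (\int[mu]_y ((c1 y)%:E * ((\1_[set z : R | (s < z)%R] (w + y))%:E *
    (q m.+1 (nu * m%:R + 1) (t - w - y))%:E)))%E.

Lemma later_arrivals_ge0 s t m w : (0 <= later_arrivals s t m w)%E.
Proof. by apply: integral_ge0 => y _; rewrite !mule_ge0 ?lee_fin. Qed.

Let measurable_later (s t : R) m :
  measurable_fun setT (fun z : R * R => (\1_[set z : R | (s < z)%R] (z.1 + z.2))%:E *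
    (q m.+1 (nu * m%:R + 1) (t - z.1 - z.2))%:E)%E.
Proof.
apply: emeasurable_funM; apply/measurable_EFinP.
  apply: measurableT_comp; last exact: measurable_funD.
  rewrite (_ : [set z : R | s < z] = `]s, +oo[%classic).
    exact: measurable_indic.
  by apply/seteqP; split => z; rewrite /= in_itv/= andbT.
apply: measurableT_comp; first exact: measurable_ml_kernel.
by apply: measurable_funB => //; exact: measurable_funB.
Qed.

Lemma measurable_later_arrivals s t m : measurable_fun setT (later_arrivals s t m).
Proof.
apply: (@measurable_fun_fubini_tonelli_F _ _ _ _ _ mu (fun z : R * R =>
    (c1 z.2)%:E * ((\1_[set z : R | (s < z)%R] (z.1 + z.2))%:E *
    (q m.+1 (nu * m%:R + 1) (t - z.1 - z.2))%:E))%E).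
  apply: emeasurable_funM; last exact: measurable_later.
  by apply/measurable_EFinP; exact: measurableT_comp.
by move=> z; rewrite !mule_ge0 ?lee_fin.
Qed.

(** Beyond y = t - w the kernel of the later events vanishes, below y = s - w the
    indicator does: the integral over the line reduces to the interval. *)
Lemma inner_integral (s t w : R) m : 0 <= w -> w <= s -> s <= t ->
  (\int[mu]_(y in `[(s - w)%R, (t - w)%R])
    (y `^ (nu - 1) * mittag_leffler 1 nu nu (- lambda * y `^ nu) *
     (t - w - y) `^ (nu * m%:R) *
     mittag_leffler m.+1%:R nu (nu * m%:R + 1) (- lambda * (t - w - y) `^ nu))%:E =
   later_arrivals s t m w)%E.
Proof.
move=> w0 ws st.
have sw0 : 0 <= s - w by rewrite subr_ge0.
have E y : s - w < y < t - w ->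
    y `^ (nu - 1) * mittag_leffler 1 nu nu (- lambda * y `^ nu) *
     (t - w - y) `^ (nu * m%:R) *
     mittag_leffler m.+1%:R nu (nu * m%:R + 1) (- lambda * (t - w - y) `^ nu) =
    q 1 nu y * q m.+1 (nu * m%:R + 1) (t - w - y).
  move=> /andP[swy ytw].
  by rewrite !ml_kernelE ?subr_gt0// ?(le_lt_trans sw0)// addrK !mulrA.
have mqq (D : set R) : measurable_fun D
    (fun y : R => (q 1 nu y * q m.+1 (nu * m%:R + 1) (t - w - y))%:E).
  apply/measurable_EFinP; apply: measurable_funTS; apply: measurable_funM.
    exact: measurable_ml_kernel.
  by apply: measurableT_comp; [exact: measurable_ml_kernel|exact: measurable_funB].
rewrite (@integral_itv_bndoo R (s - w) (t - w) _ true false); last first.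
  apply: eq_measurable_fun (mqq _) => y; rewrite inE/= in_itv/= => ys.
  by rewrite E.
transitivity (\int[mu]_(y in `](s - w)%R, (t - w)%R[)
    (q 1 nu y * q m.+1 (nu * m%:R + 1) (t - w - y))%:E)%E.
  by apply: eq_integral => y; rewrite inE/= in_itv/= => /E ->.
rewrite integral_mkcond; apply: ae_eq_integral => //.
- by apply/(measurable_restrictT (fun y : R =>
    (q 1 nu y * q m.+1 (nu * m%:R + 1) (t - w - y))%:E)).
- apply: emeasurable_funM; first exact/measurable_EFinP.
  apply: (measurableT_comp (measurable_later s t m) (g := fun y => (w, y))).
  exact: measurable_fun_pair.
- apply: filterS q1 => y q1y _.
  have c1E : c1 y = q 1 nu y by exact/max_idPr.
  rewrite /patch mem_setE in_itv/= indicE.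
  have [swy|swy] := ltP (s - w) y; last first.
    rewrite memNset ?mul0e ?mule0//=.
    by apply/negP; rewrite -leNgt addrC -lerBrDr.
  rewrite mem_set/=; last by rewrite addrC -ltrBlDr.
  have [ytw|ytw] := ltP y (t - w); first by rewrite mul1e c1E EFinM.
  by rewrite ml_kernel_le0 ?subr_le0// !mule0.
Qed.

(** [prob_renewals] starts the process afresh after the (k+1)-st event, and
    the freezing lemma then integrates over the interarrival time before it. *)
Lemma prob_counts_lt (s t : R) k m :
  P ([set w | arrival X k w <= s < arrival X k.+1 w] `&`
     [set w | arrival X (k.+1 + m) w <= t < arrival X (k.+1 + m).+1 w]) =
  ((lambda ^+ m.+1)%:E * \int[P]_w ((\1_[set x | (x <= s)%R] (arrival X k w))%:E *
    later_arrivals s t m (arrival X k w)))%E.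
Proof.
pose C : set (R * R) := [set z | z.1 <= s < z.1 + z.2].
have mC : measurable C.
  have -> : C = (fun z : R * R => (z.1 <= s) && (s < z.1 + z.2)) @^-1` [set true] by [].
  rewrite -[X in measurable X]setTI.
  suff : measurable_fun setT (fun z : R * R => (z.1 <= s) && (s < z.1 + z.2)) by apply.
  apply: measurable_and; first exact: measurable_fun_ler.
  by apply: measurable_fun_ltr => //; exact: measurable_funD.
have mle : measurable [set x : R | x <= s].
  by rewrite (_ : [set x : R | x <= s] = `]-oo, s]%classic).
have m1 : measurable_fun setT (fun x : R => (\1_[set y : R | y <= s] x)%:E : \bar R).
  by apply/measurable_EFinP; exact: measurable_indic.
have aC := adaptedS (adaptedT k) mC; rewrite setTI in aC.
rewrite (_ : [set w | arrival X k w <= s < arrival X k.+1 w] =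
    [set w | C (arrival X k w, X k w)]); last first.
  by apply/seteqP; split => w; rewrite /C/= arrivalS.
rewrite (prob_renewals mF F0 XF)//.
transitivity (\int[P]_w ((\1_[set: T] w)%:E *
    ((\1_C (arrival X k w, X k w))%:E *
      renewal_prob F m (t - (arrival X k w + X k w))%R)))%E.
  by apply: eq_integral => w _; rewrite indicT mul1e arrivalS.
rewrite (@freezing_density _ _ _ P X F mF XF k setT
  (fun z => (\1_C z)%:E * renewal_prob F m (t - (z.1 + z.2))%R)%E); last 3 first.
- exact: adaptedT.
- apply: emeasurable_funM; first by apply/measurable_EFinP; exact: measurable_indic.
  apply: measurableT_comp; first exact: measurable_renewal_prob.
  by apply: measurable_funB => //; exact: measurable_funD.
- by move=> z; rewrite mule_ge0 ?lee_fin ?renewal_prob_ge0.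
rewrite -ge0_integralZl_EFin//; first last.
- by rewrite exprn_ge0// ltW.
- apply: emeasurable_funM.
    by apply: (measurableT_comp m1); exact: measurable_arrival.
  apply: measurableT_comp; last exact: measurable_arrival.
  exact: measurable_later_arrivals.
- by move=> w _; rewrite mule_ge0 ?lee_fin ?later_arrivals_ge0.
apply: eq_integral => w _; rewrite indicT mul1e; set u := arrival X k w.
transitivity (\int[mu]_y (((lambda ^+ m.+1)%:E * (\1_[set x | (x <= s)%R] u)%:E) *
  ((c1 y)%:E * ((\1_[set z : R | (s < z)%R] (u + y))%:E *
    (q m.+1 (nu * m%:R + 1) (t - u - y))%:E))))%E; last first.
  rewrite ge0_integralZl//.
  - by rewrite muleA.
  - apply: emeasurable_funM; first exact/measurable_EFinP.
    apply: (measurableT_comp (measurable_later s t m) (g := fun y => (u, y))).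
    exact: measurable_fun_pair.
  - by move=> y _; rewrite !mule_ge0 ?lee_fin.
  - by rewrite mule_ge0 ?lee_fin// exprn_ge0// ltW.
apply: ae_eq_integral => //.
- apply: emeasurable_funM; first exact/measurable_EFinP.
  apply: emeasurable_funM.
    apply/measurable_EFinP; apply: (measurableT_comp (measurable_indic mC)).
    exact: measurable_fun_pair.
  apply: measurableT_comp; first exact: measurable_renewal_prob.
  by rewrite /=; apply: measurable_funB => //; exact: measurable_funD.
- apply: emeasurable_funM => //; apply: emeasurable_funM; first exact/measurable_EFinP.
  apply: (measurableT_comp (measurable_later s t m) (g := fun y => (u, y))).
  exact: measurable_fun_pair.
- apply: filterS (ae_neq (t - u)) => y ytu _.
  rewrite /= opprD addrA (renewal_prob_kernel lambda0 nu0 q1)//; last first.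
    by rewrite subr_eq0 eq_sym.
  have -> : F y = lambda * c1 y.
    by rewrite /interarrival_density /c1 maxr_pMr ?mulr0// ltW.
  have -> : \1_C (u, y) = \1_[set x | x <= s] u * \1_[set z | s < z] (u + y) :> R.
    rewrite !indicE -natrM mulnb; congr (_%:R); congr nat_of_bool.
    by apply/idP/andP; rewrite !inE /C/= => /andP.
  by rewrite -!EFinM; congr EFin; rewrite exprS; ring.
Qed.

(** That no event falls between T_k and t already says that T_{k+1} > s, so the
    past only enters through T_k <= s. *)
Lemma prob_counts_eq (s t : R) k : s <= t ->
  P ([set w | arrival X k w <= s < arrival X k.+1 w] `&`
     [set w | arrival X k w <= t < arrival X k.+1 w]) =
  (\int[P]_w ((\1_[set x | (x <= s)%R] (arrival X k w))%:E *
    renewal_prob F 0 (t - arrival X k w)))%E.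
Proof.
move=> st.
have mle : measurable [set x : R | x <= s].
  by rewrite (_ : [set x : R | x <= s] = `]-oo, s]%classic).
have aE := adapted_cut (adaptedT k) mle; rewrite setTI in aE.
rewrite (_ : _ `&` _ = (arrival X k @^-1` [set x : R | x <= s]) `&`
  [set w | arrival X (k + 0) w <= t < arrival X (k + 0).+1 w]); last first.
  apply/seteqP; split => w /=; rewrite addn0.
    by move=> [/andP[]].
  move=> [Ss /andP[-> St]]; rewrite Ss St; split => //=.
  exact: le_lt_trans St.
by rewrite (prob_renewals mF F0 XF).
Qed.

(** At u = 0 the kernel vanishes and cannot be used, but both sides are 1. *)
Lemma survival (u : R) : 0 <= u ->
  renewal_prob F 0 u = (mittag_leffler 1 nu 1 (- lambda * u `^ nu))%:E.
Proof.
rewrite le_eqVlt => /predU1P[<-|u0]; last first.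
  rewrite (renewal_prob_kernel lambda0 nu0 q1) ?gt_eqF// expr0 mul1r mulr0 add0r.
  by rewrite ml_kernelE// subrr powRr0 mul1r.
rewrite powR0 ?gt_eqF// mulr0.
have -> : mittag_leffler 1 nu 1 0 = 1 :> R.
  apply: lim_near_cst => //; near=> n.
  have n0 : (0 < n)%N by near: n; exact: nbhs_infty_gt.
  rewrite /series/= big_ltn// big_nat big1 => [|[//|j] _].
    by rewrite mulr0 add0r !addr0 Gamma1 expr0 !mulr1 divff.
  by rewrite expr0n/= mulr0 mul0r.
rewrite /= -integral_F; apply: eq_integral => x _; rewrite indicE.
have [x0|x0] := ltP 0 x; first by rewrite mem_set ?mule1//= lexx.
by rewrite /interarrival_density ml_kernel_le0// mulr0 maxxx mul0e.
Unshelve. all: by end_near. Qed.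

Lemma ae_positive : {ae P, forall w, forall n, 0 < X n w}.
Proof.
have H n : P.-negligible [set w | ~ 0 < X n w].
  exists (X n @^-1` `]-oo, 0]%classic); split.
  - by rewrite -[X in measurable X]setTI; exact: measurable_funP.
  - rewrite -[LHS]/(distribution P (X n) `]-oo, 0]%classic) XF// integral0_eq// => x.
    rewrite /= in_itv/= => x0.
    by rewrite /interarrival_density ml_kernel_le0// mulr0 maxxx.
  - by move=> w /= /negP; rewrite -leNgt in_itv.
have := negligible_bigcup H; apply: negligibleS => w /= /existsNP[n nX].
by exists n.
Qed.

Let measurable_arrival_le n (u : R) : measurable [set w | arrival X n w <= u].
Proof.
rewrite (_ : [set w | _] = arrival X n @^-1` `]-oo, u]%classic).
  by rewrite -[X in measurable X]setTI; exact: measurable_arrival.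
by apply/seteqP; split => w /=; rewrite in_itv.
Qed.

Let measurable_between n (u : R) :
  measurable [set w | arrival X n w <= u < arrival X n.+1 w].
Proof.
rewrite (_ : [set w | _] = [set w | arrival X n w <= u] `\` [set w | arrival X n.+1 w <= u]).
  exact: measurableD.
apply/seteqP; split => w /=; rewrite ltNge; first by move=> /andP[? /negP].
by move=> [-> /negP].
Qed.

(** Almost surely the interarrival times are positive, hence the event times
    increase and the number of events up to u is k if and only if u lies between
    the k-th and the next one.  Elsewhere the two events may differ. *)
Lemma prob_counting (N : R -> T -> \bar R) (s t : R) k r :
  (forall u w, 0 <= u ->
    N u w = counting [set n | event_time (fun i => X i : T -> R) n w <= u]) ->
  0 <= s -> 0 <= t ->
  P [set w | N s w = k%:R%:E /\ N t w = r%:R%:E] =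
  P ([set w | arrival X k w <= s < arrival X k.+1 w] `&`
     [set w | arrival X r w <= t < arrival X r.+1 w]).
Proof.
move=> NE s0 t0; set A := [set w | _ /\ _]; set B := _ `&` _.
have mcount u (j : nat) : 0 <= u -> measurable [set w | N u w = j%:R%:E].
  move=> u0; rewrite -[X in measurable X]setTI.
  have : measurable_fun setT (N u).
    rewrite (_ : N u = fun w => counting [set n | [set w | arrival X n.+1 w <= u] w]).
      exact: measurable_counting.
    by apply/funext => w; rewrite NE.
  by move=> mN; exact: (mN measurableT [set j%:R%:E]).
have mA : measurable A by apply: measurableI; exact: mcount.
have mB : measurable B by exact: measurableI.
suff AB : ae_eq P setT (fun w => (\1_A w)%:E : \bar R) (fun w => (\1_B w)%:E).
  rewrite -[A]setIT -[B]setIT -!integral_indic//.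
  by apply: ae_eq_integral => //; apply/measurable_EFinP; exact: measurable_indic.
apply: filterS ae_positive => w Xpos _.
have ndS : {homo (fun n => arrival X n w) : i j / (i <= j)%N >-> i <= j}.
  apply/nondecreasing_seqP => n /=.
  by rewrite arrivalS lerDl ltW.
have countE u j : 0 <= u -> N u w = j%:R%:E <-> arrival X j w <= u < arrival X j.+1 w.
  move=> u0; rewrite NE//.
  have S0 : arrival X 0 w <= u by rewrite /arrival big_ord0.
  exact: (@counting_partial_sums R (fun n => arrival X n w) u j S0 ndS).
congr EFin; rewrite !indicE; congr (_%:R); congr nat_of_bool.
apply/idP/idP; rewrite !inE /A /B /=.
  by move=> [/countE ? /countE ?]; split; auto.
by move=> [? ?]; split; apply/countE.
Qed.

End bivariate.

(* The integral formula is defined only when its upper parameters k and r - k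
   are positive: first clause.  When k = 0 the kernel
   lambda^k w^(nu k - 1) E^k_{nu,nu k}(- lambda w^nu) dw, the law of the time of
   the k-th event, degenerates into the Dirac mass at w = 0: second clause.
   When r = k no convention makes the printed formula true (at t = s > 0 it
   vanishes whereas the probability is positive): the last two clauses give the
   probability, that is, the event after the k-th one occurs after time t. *)
Theorem theorem2p1 (d : measure_display) (Omega : measurableType d)
    (R : realType) (P : probability Omega R) (lambda nu : R)
    (hlambda : 0 < lambda) (hnu0 : 0 < nu) (hnu1 : nu <= 1)
    (N : R -> Omega -> \bar R)
    (hN : fractional_poisson_process P lambda nu N)
    (s t : R) (hs : 0 <= s) (hst : s <= t) (k r : nat) (hkr : (k <= r)%N) :
  let prob : \bar R := P [set w | N s w = k%:R%:E /\ N t w = r%:R%:E] in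
  let outer (w : R) : R :=
    w `^ (nu * k%:R - 1)
    * mittag_leffler k%:R nu (nu * k%:R) (- lambda * w `^ nu) in
  let inner (w : R) : \bar R :=
    (\int[@lebesgue_measure R]_(y in `[(s - w)%R, (t - w)%R])
      (y `^ (nu - 1) * mittag_leffler 1 nu nu (- lambda * y `^ nu)
       * (t - w - y) `^ (nu * (r%:R - k%:R - 1))
       * mittag_leffler (r%:R - k%:R) nu (nu * (r%:R - k%:R - 1) + 1)
           (- lambda * (t - w - y) `^ nu))%:E)%E in
  [/\ (0 < k < r)%N ->
        prob = ((lambda ^+ r)%:E *
          \int[@lebesgue_measure R]_(w in `[0%R, s]) ((outer w)%:E * inner w))%E,
      (k = 0)%N -> (0 < r)%N ->
        prob = ((lambda ^+ r)%:E * inner 0%R)%E,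
      (0 < k)%N -> r = k ->
        prob = ((lambda ^+ k)%:E *
          \int[@lebesgue_measure R]_(w in `[0%R, s])
            (outer w * mittag_leffler 1 nu 1 (- lambda * (t - w) `^ nu))%:E)%E &
      (k = 0)%N -> r = 0%N ->
        prob = (mittag_leffler 1 nu 1 (- lambda * t `^ nu))%:E].
Proof.
move: hN => [X [iX dX NE]] prob outer inner.
have ht : 0 <= t by exact: le_trans hst.
have probE : prob = P ([set w | arrival X k w <= s < arrival X k.+1 w] `&`
    [set w | arrival X r w <= t < arrival X r.+1 w]).
  exact: (prob_counting hlambda hnu0 dX k r NE hs ht).
have arr0 w : arrival X 0 w = 0 by rewrite /arrival big_ord0.
have ind0 : \1_[set x : R | x <= s] 0 = 1 :> R by rewrite indicE mem_set.
have mJ m := measurable_later_arrivals hlambda hnu0 dX s t m.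
have J0 m := later_arrivals_ge0 hlambda hnu0 dX s t m.
pose F := interarrival_density lambda nu.
have mF : measurable_fun setT F := measurable_interarrival_density lambda hnu0.
have F0 : forall x, 0 <= F x := interarrival_density_ge0 lambda nu.
have innerE m w : r = (k.+1 + m)%N -> 0 <= w -> w <= s ->
    inner w = later_arrivals lambda nu s t m w.
  move=> rE w0 ws; rewrite -(inner_integral hlambda hnu0 dX m w0 ws hst).
  have rk : r%:R - k%:R = m.+1%:R :> R.
    by rewrite rE addSnnS natrD addrC addKr.
  have rk1 : r%:R - k%:R - 1 = m%:R :> R by rewrite rk -natr1 addrK.
  by rewrite /inner rk1 rk.
split.
- move=> /andP[k0 kr]; rewrite probE.
  have [m rE] : exists m, r = (k.+1 + m)%N by exists (r - k.+1)%N; rewrite subnKC.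
  rewrite [in P _]rE (prob_counts_lt hlambda hnu0 iX dX).
  have {}innerE w : 0 < w < s -> inner w = later_arrivals lambda nu s t m w.
    by move=> /andP[w0 ws]; exact: (innerE m w rE (ltW w0) (ltW ws)).
  have kE := prednK k0.
  rewrite /outer -{1 2}kE.
  rewrite (integral_arrival_itv hlambda hnu0 iX dX k.-1 (mJ m) (J0 m) innerE).
  by rewrite muleA -EFinM -exprD kE addSnnS addnC -rE.
- move=> k0 r0; rewrite probE.
  have rE : r = (k.+1 + r.-1)%N by rewrite k0 add1n prednK.
  rewrite [in P _]rE (prob_counts_lt hlambda hnu0 iX dX) k0.
  have innerE0 : inner 0 = later_arrivals lambda nu s t r.-1 0.
    exact: (innerE r.-1 0 rE (lexx 0) hs).
  rewrite innerE0 (prednK r0).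
  apply: (congr1 (mule _)); rewrite -[RHS](integral_prob_cst P).
  by apply: eq_integral => w _; rewrite arr0 ind0 mul1e.
- move=> k0 rk; rewrite probE rk (prob_counts_eq hlambda hnu0 iX dX k hst).
  have mE : measurable_fun setT (fun w : R => renewal_prob F 0 (t - w)).
    apply: measurableT_comp; last exact: measurable_funB.
    exact: (measurable_renewal_prob mF F0).
  have survE w : 0 < w < s ->
      (mittag_leffler 1 nu 1 (- lambda * (t - w) `^ nu))%:E = renewal_prob F 0 (t - w).
    move=> /andP[_ ws]; rewrite (survival hlambda hnu0 dX)// subr_ge0.
    exact: le_trans (ltW ws) hst.
  have kE := prednK k0.
  rewrite /outer -{1 2}kE.
  rewrite (integral_arrival_itv hlambda hnu0 iX dX k.-1 mE
    (fun w => renewal_prob_ge0 F0 0 (t - w)) survE) kE.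
  apply: (congr1 (mule _)); apply: eq_integral => w _.
  by rewrite -EFinM.
- move=> k0 r0; rewrite probE k0 r0 (prob_counts_eq hlambda hnu0 iX dX 0 hst).
  rewrite -(survival hlambda hnu0 dX ht) -[RHS](integral_prob_cst P).
  by apply: eq_integral => w _; rewrite arr0 ind0 mul1e subr0.
Qed.
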